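(* Let $(X;G,H)$ be a projecting decomposition. Then there is a split short exact sequence \[ 0\to \mathrm{MH}_{*,*}(G\cap H)\xrightarrow{(j^G_*,\,-j^H_* )}\mathrm{MH}_{*,*}(G)\oplus\mathrm{MH}_{*,*}(H)\xrightarrow{i^G_*\oplus i^H_*}\mathrm{MH}_{*,*}(G\cup H)\to 0 , \] where the second map is $(a,b)\mapsto i^G_*(a)+i^H_*(b)$. The sequence is natural with respect to decomposition maps, and the splitting (can be chosen for all projecting decompositions so that it) is natural with respect to projecting decomposition maps.
   Context: A graph is a finite undirected graph with no loops or multiple edges. $d_G(x,y)$ is the length of a shortest edge path from $x$ to $y$ in $G$ ($\infty$ if in different components). The length of a tuple of vertices is $\ell(x_0,\dots,x_k)=\sum_{i=1}^{k} d(x_{i-1},x_i)$. $\mathrm{MC}_{k,l}(G)$ ($k,l\ge0$) is the free abelian group on tuples $(x_0,\dots,x_k)$ of vertices with consecutive entries distinct and $\ell(x_0,\dots,x_k)=l$. The differential $\partial\colon \mathrm{MC}_{k,l}(G)\to\mathrm{MC}_{k-1,l}(G)$ is $\partial=\sum_{i=1}^{k-1}(-1)^i\partial_i$, where $\partial_i$ omits the $i$-th entry $x_i$ if the resulting tuple still has length $l$, and is $0$ otherwise. $\mathrm{MH}_{k,l}(G)=H_k(\mathrm{MC}_{*,l}(G))$. A map of graphs $f\colon G\to G'$ is a map $V(G)\to V(G')$ such that for each edge $\{x,y\}$ of $G$, either $\{f(x),f(y)\}$ is an edge of $G'$ or $f(x)=f(y)$. It induces a chain map sending $(x_0,\dots,x_k)$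 to $(f(x_0),\dots,f(x_k))$ if this has the same length as $(x_0,\dots,x_k)$, and to $0$ otherwise; $f_*$ is the induced map on $\mathrm{MH}_{*,*}$. A subgraph $U\subset X$ is convex if $d_U(u,v)=d_X(u,v)$ for all vertices $u,v$ of $U$. For $U\subset X$ convex, $X$ projects to $U$ if for every vertex $x$ of $X$ that can be connected by an edge path to some vertex of $U$ there is a vertex $\pi(x)\in U$ such that $d(x,u)=d(x,\pi(x))+d(\pi(x),u)$ for all $u\in U$ (so $\pi(x)$ is the unique point of $U$ closest to $x$). $X_U$ denotes the part of $X$ consisting of the vertices that admit an edge path to $U$, and $\pi\colon X_U\to U$ is the resulting map. A projecting decomposition $(X;G,H)$ is a graph $X$ with subgraphs $G,H$ such that $X=G\cup H$, $G\cap H$ is convex in $X$, and $H$ projects to $G\cap H$. The maps $i^G\colon G\to X$, $i^H\colon H\to X$, $j^G\colon G\cap H\to G$, $j^H\colon G\cap H\to H$ are the inclusions. A decomposition map $f\colon(X;G,H)\to(X';G',H')$ is a map of graphs $f\colon X\to X'$ with $f(G)\subset G'$ and $f(H)\subset H'$. It is a projecting decomposition map if $H_{G\cap H}=f^{-1}(H'_{G'\cap H'})$ and $f(\pi(h))=\pi(f(h))$ for all $h\in H_{G\cap H}$. *)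

(* Defs.v *)
From HB Require Import structures.
From mathcomp Require Import all_boot all_order all_algebra.
From mathcomp Require Import boolp zify.

Set Implicit Arguments.
Unset Strict Implicit.
Unset Printing Implicit Defensive.

Import GRing.Theory.
Local Open Scope ring_scope.

(* A finite simple graph whose vertices are drawn from a finite type T, edges *)
(* being 2-element sets of vertices.  As with {group gT}, keeping the ambient *)
(* type T lets subgraphs, unions and intersections live in the same type.     *)
Record graph (T : finType) := Graph {
  vert : {set T};
  edge : {set {set T}};
  edge_subproof : [forall e in edge, (e \subset vert) && (#|e| == 2)] }.

Section Graphs.
Variable T : finType.
Implicit Types (G H U X : graph T) (x y u v : T) (s : seq T).

Definition adj G : rel T := fun x y => [set x; y] \in edge G.

Lemma graphU_subproof G H :
  [forall e in edge G :|: edge H,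
     (e \subset vert G :|: vert H) && (#|e| == 2)].
Proof.
apply/forall_inP => e; rewrite inE => /orP[] he.
  have /forall_inP /(_ e he) /andP[sV ->] := edge_subproof G.
  by rewrite andbT (subset_trans sV) ?subsetUl.
have /forall_inP /(_ e he) /andP[sV ->] := edge_subproof H.
by rewrite andbT (subset_trans sV) ?subsetUr.
Qed.
Definition graphU G H := Graph (graphU_subproof G H).

Lemma graphI_subproof G H :
  [forall e in edge G :&: edge H,
     (e \subset vert G :&: vert H) && (#|e| == 2)].
Proof.
apply/forall_inP => e; rewrite inE => /andP[hG hH].
have /forall_inP /(_ e hG) /andP[sG ->] := edge_subproof G.
have /forall_inP /(_ e hH) /andP[sH _] := edge_subproof H.
by rewrite andbT subsetI sG.
Qed.
Definition graphI G H := Graph (graphI_subproof G H).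

Definition subgraph U X := (vert U \subset vert X) && (edge U \subset edge X).

Lemma adj_sym G x y : adj G x y = adj G y x.
Proof. by rewrite /adj setUC. Qed.

Lemma adj_neq G x y : adj G x y -> x != y.
Proof.
move=> xy; have /forall_inP /(_ _ xy) /andP[_] := edge_subproof G.
by rewrite cards2; case: (x != y).
Qed.

Lemma adj_vert G x y : adj G x y -> (x \in vert G) && (y \in vert G).
Proof.
move=> xy; have /forall_inP /(_ _ xy) /andP[/subsetP sV _] := edge_subproof G.
by rewrite !sV ?set21 ?set22.
Qed.

Lemma adj_graphI G H x y : adj (graphI G H) x y = adj G x y && adj H x y.
Proof. by rewrite /adj inE. Qed.

Lemma adj_graphU G H x y : adj (graphU G H) x y = adj G x y || adj H x y.
Proof. by rewrite /adj inE. Qed.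

(* Distances and lengths are in option nat, None standing for infinity. *)
Definition oadd (a b : option nat) : option nat :=
  if a is Some m then if b is Some n then Some (m + n)%N else None else None.

Definition walk G (n : nat) x y :=
  [exists p : n.-tuple T, path (adj G) x p && (last x p == y)].

Lemma walkP G n x y :
  reflect (exists p, [/\ path (adj G) x p, last x p = y & size p = n])
          (walk G n x y).
Proof.
apply: (iffP existsP) => [[p /andP[pp /eqP lp]]|[p [pp lp sp]]].
  by exists p; rewrite size_tuple.
have sp' : size p == n by apply/eqP.
by exists (Tuple sp'); rewrite /= pp lp eqxx.
Qed.

Lemma walk_connect G x y : connect (adj G) x y -> exists n, walk G n x y.
Proof. by move=> /connectP[p pp ->]; exists (size p); apply/walkP; exists p. Qed.

Definition dist G x y : option nat :=
  match @idP (connect (adj G) x y) with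
  | ReflectT xy => Some (ex_minn (walk_connect xy))
  | ReflectF _ => None
  end.

Fixpoint length G s : option nat :=
  if s is x :: s' then
    if s' is y :: _ then oadd (dist G x y) (length G s') else Some 0%N
  else Some 0%N.

Definition convex U X :=
  forall u v, u \in vert U -> v \in vert U -> dist U u v = dist X u v.

(* The vertex set of the part X_U of X. *)
Definition reach X U : {set T} :=
  [set x in vert X | [exists u in vert U, connect (adj X) x u]].

Definition is_proj X U x p :=
  (p \in vert U) &&
  [forall u in vert U, dist X x u == oadd (dist X x p) (dist X p u)].

Definition projects X U :=
  [/\ subgraph U X, convex U X & forall x, x \in reach X U -> exists p, is_proj X U x p].

(* Meaningful only on X_U, where the point p is unique when X projects to U.  *)
Definition proj X U x : T := odflt x [pick p | is_proj X U x p].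

Lemma dist_path G x y m : dist G x y = Some m ->
  exists p, [/\ path (adj G) x p, last x p = y & size p = m].
Proof.
rewrite /dist; case: {-}_ / idP => // xy [<-].
by case: ex_minnP => n /walkP.
Qed.

Lemma dist_le G x p : path (adj G) x p ->
  exists2 m, dist G x (last x p) = Some m & (m <= size p)%N.
Proof.
move=> pp; rewrite /dist; case: {-}_ / idP => [xy|[]]; last first.
  by apply/connectP; exists p.
case: ex_minnP => n _ min_n; exists n => //; apply: min_n.
by apply/walkP; exists p.
Qed.

Lemma distxx G x : dist G x x = Some 0%N.
Proof. by have [m ->] := @dist_le G x [::] isT; rewrite leqn0 => /eqP->. Qed.

Lemma dist0 G x y : dist G x y = Some 0%N -> x = y.
Proof. by move=> /dist_path[p [_ <- /size0nil->]]. Qed.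

Lemma dist_triangle G x y z m n : dist G x y = Some m -> dist G y z = Some n ->
  exists2 q, dist G x z = Some q & (q <= m + n)%N.
Proof.
move=> /dist_path[p [pp lp sp]] /dist_path[r [pr lr sr]].
have := @dist_le G x (p ++ r); rewrite cat_path last_cat size_cat lp pp pr lr sp sr.
exact.
Qed.

Lemma lengthS G x y s m : length G [:: x, y & s] = Some m ->
  exists a b, [/\ dist G x y = Some a, length G (y :: s) = Some b & m = (a + b)%N].
Proof.
rewrite [length _ _]/= -/(length G (y :: s)).
by case: (dist G x y) => // a; case: (length G (y :: s)) => // b [<-]; exists a, b.
Qed.

End Graphs.

Section MagnitudeChains.
Variables (T : finType) (G : graph T).
Implicit Types (k l i : nat) (s : seq T).

Definition is_gen l s :=
  [&& all [in vert G] s, sorted (fun x y => x != y) s & length G s == Some l].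

Definition mtuple k l := {t : k.+1.-tuple T | is_gen l t}.

(* The basis element given by s if s is one of the generating tuples of       *)
(* degree k and length l, and 0 otherwise.                                    *)
Definition gen k l s : {ffun mtuple k l -> int} := [ffun t => (tval (val t) == s)%:R].

Definition del i s := take i s ++ drop i.+1 s.

End MagnitudeChains.
Arguments gen {T} G k l s.
Arguments mtuple {T} G k l.

(* Finitely many tuples have a given degree and length, so the free abelian   *)
(* group on them consists of all integer-valued functions.                    *)
Notation MC G k l := {ffun mtuple G k l -> int}.

Definition lin_ext (I : finType) (V : zmodType) (F : I -> V)
  (c : {ffun I -> int}) : V := \sum_i F i *~ c i.

Lemma lin_ext_is_zmod_morphism (I : finType) (V : zmodType) (F : I -> V) :
  zmod_morphism (lin_ext F).
Proof.
move=> c d; rewrite /lin_ext -sumrB; apply: eq_bigr => i _.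
by rewrite !ffunE mulrzBr.
Qed.
HB.instance Definition _ I V F :=
  GRing.isZmodMorphism.Build _ _ (@lin_ext I V F) (lin_ext_is_zmod_morphism F).


Lemma lin_ext_gen (T : finType) (G : graph T) (V : zmodType) (F : seq T -> V)
    k l s :
  lin_ext (fun t : mtuple G k l => F (val t)) (gen G k l s) =
  if (size s == k.+1) && is_gen G l s then F s else 0.
Proof.
rewrite /lin_ext; case: ifPn => [/andP[sk gs]|ngs].
  pose t : mtuple G k l := Sub (Tuple sk) gs.
  rewrite (bigD1 t) //= ffunE /= eqxx mulr1z big1 ?addr0 // => u /negPf ut.
  rewrite ffunE; case: eqP => [us|]; last by rewrite mulr0z.
  by move: ut; rewrite -val_eqE /= -val_eqE /= us eqxx.
rewrite big1 // => t _; rewrite ffunE; case: eqP => [ts|]; last by rewrite mulr0z.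
by case/negP: ngs; rewrite -ts size_tuple eqxx (valP t).
Qed.

Lemma gen_length (T : finType) (G : graph T) k l s :
  length G s != Some l -> gen G k l s = 0.
Proof.
move=> ls; apply/ffunP => t; rewrite !ffunE; case: eqP => // ts.
by case/and3P: (valP t); rewrite ts (negPf ls).
Qed.

(* Deleting an inner entry x_i of a generating tuple of length l yields       *)
(* either a generating tuple of length l or a tuple of smaller length (see    *)
(* is_gen_del), and on the latter gen is 0.                                   *)
Definition bdry_gen (T : finType) (G : graph T) k l s : MC G k.-1 l :=
  \sum_(1 <= i < k) gen G k.-1 l (del i s) *~ (-1) ^+ i.

(* In degree 0 the sum is empty, and the target MC G 0.-1 l is irrelevant.    *)
Definition bdry (T : finType) (G : graph T) k l : MC G k l -> MC G k.-1 l :=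
  lin_ext (fun t : mtuple G k l => bdry_gen G k l (val t)).
HB.instance Definition _ T (G : graph T) k l :=
  GRing.Additive.copy (@bdry T G k l)
    (lin_ext (fun t : mtuple G k l => bdry_gen G k l (val t))).
Arguments bdry {T} G k l c.


Section DelTheory.
Variables (T : finType) (G : graph T).
Implicit Types (x y z : T) (s : seq T).

Lemma size_del i s : (i < size s)%N -> size (del i s) = (size s).-1.
Proof. by move=> h; rewrite size_cat size_take size_drop h; lia. Qed.

Lemma map_del (T' : finType) (f : T -> T') i s :
  map f (del i s) = del i (map f s).
Proof. by rewrite map_cat map_take map_drop. Qed.

Lemma del_split i s : (0 < i)%N -> (i.+1 < size s)%N ->
  exists s1 x y z s2,
    s = s1 ++ [:: x, y, z & s2] /\ del i s = s1 ++ [:: x, z & s2].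
Proof.
elim: i s => // -[|i] IH [|x s] // _.
  by case: s => [|y [|z s]] // _; exists [::], x, y, z, s; rewrite /del.
rewrite ltnS => /(IH _ isT)[s1 [u [y [z [s2 [e d]]]]]].
by exists (x :: s1), u, y, z, s2; rewrite {1}e /= -d.
Qed.

Lemma del_del i j s : (j < i)%N -> (i < size s)%N ->
  del j (del i s) = del i.-1 (del j s).
Proof.
elim: j i s => [|j IH] [|i] // [|x s] //.
  by move=> _ h; rewrite /del /= !drop0.
rewrite !ltnS => ji h; case: i ji h => // i ji h; have := IH _ _ ji h.
by rewrite /del /= => ->.
Qed.

Lemma length_cat x s1 s2 :
  length G (s1 ++ x :: s2) = oadd (length G (rcons s1 x)) (length G (x :: s2)).
Proof.
have oA a b c : oadd a (oadd b c) = oadd (oadd a b) c.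
  by case: a b c => [a|] [b|] [c|] //=; rewrite addnA.
have lC u v s : length G [:: u, v & s] = oadd (dist G u v) (length G (v :: s)).
  by [].
elim: s1 => [|y [|z s1] IH].
- by rewrite cat0s [rcons _ _]/= [length G [:: x]]/=; case: (length G _).
- rewrite -[rcons _ x]/[:: y; x] cat1s !lC -[length G [:: x]]/(Some 0%N).
  by case: (dist G y x) => //= a; rewrite addn0.
- by rewrite !rcons_cons !cat_cons !lC -oA -IH.
Qed.

Lemma length_del i s m : (0 < i)%N -> (i.+1 < size s)%N ->
  length G s = Some m -> exists2 n, length G (del i s) = Some n & (n <= m)%N.
Proof.
move=> i0 /(del_split i0)[s1 [x [y [z [s2 [-> ->]]]]]]; rewrite !(length_cat x).
case: (length G (rcons s1 x)) => //= a; rewrite -/(length G (z :: s2)).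
case exy: (dist G x y) => [b|] //; case eyz: (dist G y z) => [c|] //.
case: (length G _) => // d [<-]; have [q -> hq] := dist_triangle exy eyz.
by exists (a + (q + d))%N => //; rewrite leq_add2l addnA leq_add2r.
Qed.

Lemma is_gen_del l i s : (0 < i)%N -> (i.+1 < size s)%N -> is_gen G l s ->
  is_gen G l (del i s) \/ exists2 n, length G (del i s) = Some n & (n < l)%N.
Proof.
move=> i0 si /and3P[av so /eqP ls]; have [n ln] := length_del i0 si ls.
rewrite leq_eqVlt => /orP[/eqP nl|]; last by right; exists n.
left; rewrite /is_gen ln nl eqxx andbT.
have [s1 [x [y [z [s2 [e d]]]]]] := del_split i0 si.
move: ls ln av so; rewrite d e nl !all_cat /= => ls ln.
case/and5P=> -> -> _ -> -> /=; rewrite !sorted_cat_cons /=.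
case/andP=> -> /and3P[xy yz ->]; rewrite !andbT /=; apply/eqP=> xz.
move: ls ln; rewrite !(length_cat x) -xz /= distxx.
case: (length G (rcons s1 x)) => //= a; rewrite -/(length G (x :: s2)).
case: (length G (x :: s2)) => [d'|]; last first.
  by case: (dist G x y) => // b; case: (dist G y x).
case exy: (dist G x y) => [[|b]|] //; first by rewrite (dist0 exy) eqxx in xy.
by case: (dist G y x) => // c [<-] [/eqP]; rewrite !addnE; lia.
Qed.

Lemma bdryE k l s : size s = k.+1 ->
  is_gen G l s \/ (exists2 n, length G s = Some n & (n < l)%N) ->
  bdry G k l (gen G k l s) = bdry_gen G k l s.
Proof.
move=> sk gs; rewrite /bdry lin_ext_gen sk eqxx /=; case: ifPn => // ngs.
case: gs => [gs|[n ln nl]]; first by rewrite gs in ngs.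
rewrite /bdry_gen big_nat big1 // => i /andP[i0 ik].
have [||q lq qn] := length_del (i := i) _ _ ln; rewrite ?sk //.
by rewrite gen_length ?mul0rz // lq; apply/eqP => -[]; lia.
Qed.

Lemma bdry_bdry_gen k l s : size s = k.+1 -> is_gen G l s ->
  bdry G k.-1 l (bdry_gen G k l s) = 0.
Proof.
move=> sk gs; case: k sk => [|n] sk; first by rewrite /bdry_gen big_geq // raddf0.
rewrite /bdry_gen raddf_sum [n.+1.-1]/=.
pose A i j := gen G n.-1 l (del j (del i s)) *~ (-1) ^+ j *~ (-1) ^+ i.
transitivity (\sum_(1 <= i < n.+1) \sum_(1 <= j < n) A i j).
  apply: eq_big_nat => i /andP[i0 ik]; rewrite raddfMz /= bdryE ?size_del ?sk //.
  - by rewrite /bdry_gen mulrz_suml.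
  - by rewrite ltnS leqW.
  - by apply: is_gen_del => //; rewrite sk.
have Aanti i j : (0 < j <= i)%N -> (i < n)%N -> A i.+1 j = - A j i.
  move=> /andP[j0 ji] i_n; rewrite /A del_del ?sk; [|lia|lia].
  by rewrite /= exprS mulN1r mulrNz -!mulrzA mulrC.
pose P i j := (j < i)%N.
rewrite (eq_bigr (fun i => \sum_(1 <= j < n | P i j) A i j +
           \sum_(1 <= j < n | ~~ P i j) A i j)); last first.
  by move=> i _; rewrite (bigID (P i)).
rewrite big_split /= (exchange_big_dep_nat predT) //=; apply/eqP.
rewrite addr_eq0 -sumrN; apply/eqP.
case: n sk {gs} @A @P Aanti => [|n] sk A P Aanti.
  by rewrite !big_geq.
rewrite [RHS]big_nat_recr //= [X in _ = _ + - X]big_nat_cond [X in _ = _ + - X]big_pred0 ?oppr0 ?addr0.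
  apply: eq_big_nat => j /andP[j0 jn]; rewrite -sumrN.
  rewrite big_add1 /= big_ltn_cond // {1}/P ltnS leqNgt j0 /=.
  rewrite big_nat_cond [RHS]big_nat_cond; apply: eq_big => i.
    by rewrite /P ltnS -leqNgt.
  by move=> /andP[/andP[i0 i_n] ji]; rewrite Aanti // j0.
by move=> j; rewrite /P; lia.
Qed.

Lemma bdry_bdry k l c : bdry G k.-1 l (bdry G k l c) = 0.
Proof.
rewrite {2}/bdry {1}/lin_ext raddf_sum big1 // => t _.
by rewrite raddfMz /= bdry_bdry_gen ?mul0rz ?size_tuple ?(valP t).
Qed.

End DelTheory.

Section Homology.
Variables (T : finType) (G : graph T) (k l : nat).

Definition is_cycle (c : MC G k l) := bdry G k l c == 0.

Lemma is_cycle_zmod_closed : zmod_closed is_cycle.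
Proof.
split=> [|c d /eqP c0 /eqP d0]; first by rewrite unfold_in raddf0.
by rewrite unfold_in raddfB /= c0 d0 subr0.
Qed.
HB.instance Definition _ :=
  GRing.isZmodClosed.Build (MC G k l) is_cycle is_cycle_zmod_closed.

Record cycle := Cycle { cycle_val : MC G k l; _ : is_cycle cycle_val }.
HB.instance Definition _ := [isSub for cycle_val].
HB.instance Definition _ := [Choice of cycle by <:].
HB.instance Definition _ := [SubChoice_isSubZmodule of cycle by <:].

Definition is_boundary (z : cycle) : bool :=
  `[< exists c : MC G k.+1 l, \val z = bdry G k.+1 l c >].

Lemma is_boundary_zmod_closed : zmod_closed is_boundary.
Proof.
split=> [|y z /asboolP[c yc] /asboolP[d zd]]; apply/asboolP.
  by exists 0; rewrite !raddf0.
by exists (c - d); rewrite !raddfB /= -yc -zd.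
Qed.
HB.instance Definition _ :=
  GRing.isZmodClosed.Build cycle is_boundary is_boundary_zmod_closed.

Definition MH := Quotient.quot (GRing.ZmodClosed.clone cycle is_boundary _).
HB.instance Definition _ := GRing.Zmodule.on MH.

Definition homology_class (z : cycle) : MH := (\pi_MH z)%qT.

Lemma homology_class_is_zmod_morphism : zmod_morphism homology_class.
Proof. exact: raddfB. Qed.
HB.instance Definition _ := GRing.isZmodMorphism.Build cycle MH homology_class
  homology_class_is_zmod_morphism.

Lemma homology_class_eq0 z : (homology_class z == 0) = is_boundary z.
Proof.
rewrite -(raddf0 homology_class) -[is_boundary z]/(z \in is_boundary).
by rewrite -[X in X \in _]subr0 Quotient.idealrBE.
Qed.

Lemma homology_class_repr (a : MH) : homology_class (repr a) = a.
Proof. exact: reprK. Qed.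

End Homology.
Arguments MH {T} G k l.

Definition is_gmap (T T' : finType) (f : T -> T') (G : graph T) (G' : graph T') :=
  (forall x, x \in vert G -> f x \in vert G') /\
  (forall x y, adj G x y -> adj G' (f x) (f y) \/ f x = f y).

Record gmap (T T' : finType) (G : graph T) (G' : graph T') := Gmap {
  gmap_fun :> T -> T';
  gmapP : is_gmap gmap_fun G G' }.

Section InducedMaps.
Variables (T T' : finType) (G : graph T) (G' : graph T') (f : gmap G G').
Implicit Types (x y : T) (s : seq T) (k l m : nat).

Lemma dist_gmap x y m : dist G x y = Some m ->
  exists2 n, dist G' (f x) (f y) = Some n & (n <= m)%N.
Proof.
move=> /dist_path[p [pp <- <-]]; elim: p x pp => [|z p IH] x /=.
  by exists 0%N => //; rewrite distxx.
case/andP=> xz /IH[n dn np].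
have [fxz|->] := (gmapP f).2 _ _ xz; last by exists n => //; apply: leqW.
have /(@dist_le _ G' (f x) [:: f z])[q dq q1] : path (adj G') (f x) [:: f z].
  by rewrite /= fxz.
have [r dr rq] := dist_triangle dq dn; exists r => //.
by move: q1 rq np; rewrite /=; lia.
Qed.

Lemma length_gmap s m : length G s = Some m ->
  exists2 n, length G' (map f s) = Some n & (n <= m)%N.
Proof.
elim: s m => [|x [|y s] IH] m; [by exists 0%N|by exists 0%N|].
move=> /lengthS[a [b [/dist_gmap[a' da' aa'] /IH[b' db' bb'] ->]]].
exists (a' + b')%N; last exact: leq_add.
by move: db'; rewrite /= da' => ->.
Qed.

Lemma is_gen_gmap l s : is_gen G l s ->
  is_gen G' l (map f s) \/
  exists2 n, length G' (map f s) = Some n & (n < l)%N.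
Proof.
case/and3P=> av so /eqP ls; have [n ln] := length_gmap ls.
rewrite leq_eqVlt => /orP[/eqP nl|]; last by right; exists n.
left; rewrite /is_gen ln nl eqxx andbT; apply/andP; split.
  rewrite all_map; apply: sub_all av => x; exact: (gmapP f).1.
move: ls ln so; rewrite {}nl {av}.
elim: s l => [|x [|y s] IH] l // /lengthS[a [b [da db ->]]].
move=> /lengthS[a' [b' [da' db' e]]] /andP[xy so].
have [a1 da1 aa1] := dist_gmap da; have [b1 db1 bb1] := length_gmap db.
have [ea] : Some a' = Some a1 by rewrite -da' -da1.
have [eb] : Some b' = Some b1 by rewrite -db' -db1.
have {}db' : length G' (map f (y :: s)) = Some b by rewrite [LHS]db'; congr Some; lia.
rewrite /=; apply/andP; split; last by exact: (IH b).
apply/eqP=> fxy; move: da'; rewrite fxy distxx => -[a0].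
have a00 : a = 0%N by lia.
by rewrite a00 in da; rewrite (dist0 da) eqxx in xy.
Qed.

(* By is_gen_gmap, the image of a generating tuple under f is again a         *)
(* generating tuple if it has the same length; otherwise gen is 0 on it.      *)
Definition MCmap k l : MC G k l -> MC G' k l :=
  lin_ext (fun t : mtuple G k l => gen G' k l (map f (val t))).
HB.instance Definition _ k l :=
  GRing.Additive.copy (@MCmap k l)
    (lin_ext (fun t : mtuple G k l => gen G' k l (map f (val t)))).

Lemma MCmap_genE k l s : size s = k.+1 ->
  is_gen G l s \/ (exists2 n, length G s = Some n & (n < l)%N) ->
  MCmap (gen G k l s) = gen G' k l (map f s).
Proof.
move=> sk gs; rewrite /MCmap (lin_ext_gen G (fun s => gen G' k l (map f s))).
rewrite sk eqxx /=; case: ifPn => // ngs.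
case: gs => [gs|[n ln nl]]; first by rewrite gs in ngs.
have [q lq qn] := length_gmap ln.
by rewrite gen_length // lq; apply/eqP => -[]; lia.
Qed.

Lemma MCmap_bdry k l c : bdry G' k l (MCmap c) = MCmap (bdry G k l c).
Proof.
rewrite {1}/MCmap [bdry G k l c]/bdry {1 2}/lin_ext !raddf_sum.
apply: eq_bigr => t _.
rewrite !raddfMz /=; congr (_ *~ _).
have st : size (val t) = k.+1 by rewrite size_tuple.
rewrite bdryE ?size_map //; last exact: is_gen_gmap (valP t).
rewrite /bdry_gen raddf_sum; apply: eq_big_nat => i /andP[i0 ik].
rewrite raddfMz /= MCmap_genE ?map_del ?size_del ?st //.
1-2: lia.
by apply: is_gen_del (valP t) => //; rewrite st.
Qed.

Lemma MCmap_cycle k l (z : cycle G k l) : is_cycle (MCmap (\val z)).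
Proof. by rewrite /is_cycle MCmap_bdry (eqP (valP z)) raddf0. Qed.

Definition cycle_map k l (z : cycle G k l) : cycle G' k l :=
  Cycle (MCmap_cycle z).

Lemma cycle_map_is_zmod_morphism k l : zmod_morphism (@cycle_map k l).
Proof. by move=> y z; apply: val_inj; rewrite /= !raddfB. Qed.
HB.instance Definition _ k l := GRing.isZmodMorphism.Build _ _
  (@cycle_map k l) (@cycle_map_is_zmod_morphism k l).

Definition MHmap k l (a : MH G k l) : MH G' k l :=
  homology_class (cycle_map (repr a)).

Lemma MHmap_class k l (z : cycle G k l) :
  MHmap (homology_class z) = homology_class (cycle_map z).
Proof.
apply/eqP; rewrite -subr_eq0 -!raddfB homology_class_eq0; apply/asboolP.
have : is_boundary (repr (homology_class z) - z).
  by rewrite -homology_class_eq0 raddfB /= homology_class_repr subrr.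
move=> /asboolP[c rzc]; exists (MCmap c).
by rewrite MCmap_bdry -rzc.
Qed.

Lemma MHmap_is_zmod_morphism k l : zmod_morphism (@MHmap k l).
Proof.
move=> a b; rewrite -[a]homology_class_repr -[b]homology_class_repr.
by rewrite -raddfB !MHmap_class !raddfB.
Qed.
HB.instance Definition _ k l := GRing.isZmodMorphism.Build _ _
  (@MHmap k l) (@MHmap_is_zmod_morphism k l).

End InducedMaps.

Section Inclusions.
Variables (T : finType).
Implicit Types (G H U X : graph T).

Lemma subgraph_is_gmap U X : subgraph U X -> is_gmap id U X.
Proof.
by case/andP=> /subsetP sV /subsetP sE; split=> [x /sV|x y /sE] //; left.
Qed.

Definition incl U X (UX : subgraph U X) : gmap U X := Gmap (subgraph_is_gmap UX).

Lemma graphI_subl G H : subgraph (graphI G H) G.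
Proof. by rewrite /subgraph !subsetIl. Qed.

Lemma graphI_subr G H : subgraph (graphI G H) H.
Proof. by rewrite /subgraph !subsetIr. Qed.

End Inclusions.

(* The vertex type pd_T is all of V(X), so that maps of graphs X -> X' are    *)
(* exactly functions on the types of vertices.                                *)
Record proj_decomp := ProjDecomp {
  pd_T : finType;
  pd_X : graph pd_T;
  pd_G : graph pd_T;
  pd_H : graph pd_T;
  pd_vertX : vert pd_X = [set: pd_T];
  pd_subG : subgraph pd_G pd_X;
  pd_subH : subgraph pd_H pd_X;
  pd_cover : pd_X = graphU pd_G pd_H;
  pd_convex : convex (graphI pd_G pd_H) pd_X;
  pd_projects : projects pd_H (graphI pd_G pd_H) }.

Definition pd_GH (D : proj_decomp) := graphI (pd_G D) (pd_H D).

Definition pd_iG D : gmap (pd_G D) (pd_X D) := incl (pd_subG D).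
Definition pd_iH D : gmap (pd_H D) (pd_X D) := incl (pd_subH D).
Definition pd_jG D : gmap (pd_GH D) (pd_G D) := incl (graphI_subl (pd_G D) (pd_H D)).
Definition pd_jH D : gmap (pd_GH D) (pd_H D) := incl (graphI_subr (pd_G D) (pd_H D)).

(* The inclusion f(G) of G' is one of subgraphs: vertices go to vertices of   *)
(* G', and edges to edges of G' unless they are collapsed.                    *)
Record decomp_map (D D' : proj_decomp) := DecompMap {
  dm_X :> gmap (pd_X D) (pd_X D');
  dm_subG : is_gmap dm_X (pd_G D) (pd_G D');
  dm_subH : is_gmap dm_X (pd_H D) (pd_H D') }.

Section DecompMap.
Variables (D D' : proj_decomp) (f : decomp_map D D').

Definition dm_G : gmap (pd_G D) (pd_G D') := Gmap (dm_subG f).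
Definition dm_H : gmap (pd_H D) (pd_H D') := Gmap (dm_subH f).

Lemma dm_subGH : is_gmap f (pd_GH D) (pd_GH D').
Proof.
have [fG eG] := dm_subG f; have [fH eH] := dm_subH f; split=> [x|x y].
  by rewrite !inE => /andP[/fG -> /fH ->].
rewrite /pd_GH !adj_graphI => /andP[/eG[aG|fxy] /eH[aH|?]]; try by right.
by left; rewrite aG.
Qed.
Definition dm_GH : gmap (pd_GH D) (pd_GH D') := Gmap dm_subGH.

Definition is_proj_decomp_map :=
  reach (pd_H D) (pd_GH D) = f @^-1: reach (pd_H D') (pd_GH D') /\
  forall h, h \in reach (pd_H D) (pd_GH D) ->
    f (proj (pd_H D) (pd_GH D) h) = proj (pd_H D') (pd_GH D') (f h).

End DecompMap.

Section MayerVietoris.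
Variables (k l : nat).

Definition MVin D (a : MH (pd_GH D) k l) : MH (pd_G D) k l * MH (pd_H D) k l :=
  (MHmap (pd_jG D) a, - MHmap (pd_jH D) a).

Lemma MVin_is_zmod_morphism D : zmod_morphism (@MVin D).
Proof. by move=> a b; rewrite /MVin !raddfB. Qed.
HB.instance Definition _ D :=
  GRing.isZmodMorphism.Build _ _ (@MVin D) (@MVin_is_zmod_morphism D).

Definition MVout D (ab : MH (pd_G D) k l * MH (pd_H D) k l) : MH (pd_X D) k l :=
  MHmap (pd_iG D) ab.1 + MHmap (pd_iH D) ab.2.

Lemma MVout_is_zmod_morphism D : zmod_morphism (@MVout D).
Proof. by move=> a b; rewrite /MVout !raddfB opprD addrACA. Qed.
HB.instance Definition _ D :=
  GRing.isZmodMorphism.Build _ _ (@MVout D) (@MVout_is_zmod_morphism D).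

Definition MHmap2 D D' (f : decomp_map D D')
    (ab : MH (pd_G D) k l * MH (pd_H D) k l) :
    MH (pd_G D') k l * MH (pd_H D') k l :=
  (MHmap (dm_G f) ab.1, MHmap (dm_H f) ab.2).

End MayerVietoris.

Arguments MVin {k l} D a.
Arguments MVout {k l} D ab.

Definition short_exact (A B C : zmodType) (i : {additive A -> B})
    (p : {additive B -> C}) :=
  [/\ injective i, forall b, p b = 0 <-> exists a, b = i a
    & forall c, exists b, p b = c].

(* r and s exhibit B as the direct sum of A and C.                            *)
Definition splitting (A B C : zmodType) (i : {additive A -> B})
    (p : {additive B -> C}) (r : {additive B -> A}) (s : {additive C -> B}) :=
  [/\ cancel i r, cancel s p & forall b, i (r b) + s (p b) = b].

(* Main.v *)
From HB Require Import structures.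
From mathcomp Require Import all_boot all_order all_algebra.
From mathcomp Require Import boolp zify.
Require Import Defs.

Set Implicit Arguments.
Unset Strict Implicit.
Unset Printing Implicit Defensive.

Import GRing.Theory.
Local Open Scope ring_scope.

(** A tuple of X is mixed if it has an entry outside G and an entry outside H.
    The tuples that are not mixed span a subcomplex, the sum of the images of the
    chains of G and of H, which meet in the chains of the intersection U.  The
    theorem rests on two facts.

    Excision (lemma excision): this subcomplex has the same homology as the
    chains of X.  For h in H and g in G, the projection p of h satisfies
    d(h, g) = d(h, p) + d(p, g) (lemma dist_cross).  So at the first place where a
    mixed tuple passes from one side to the other, p can be inserted without
    changing the length.  Consider the boundary operator only as far as it deletes
    entries of U: then the entries outside U are never changed, and inserting p is
    a contracting homotopy on the mixed tuples, since deleting p is always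
    possible and the other deletions commute with the insertion.  The remaining
    part of the boundary lowers the number of entries outside U, so that the
    insertion is a contracting homotopy up to terms with fewer of them (lemma
    insert_homotopy), and iterating removes all mixed tuples.

    Retraction: projecting to U maps adjacent vertices to equal or adjacent ones,
    so it induces a chain map from the chains of H, or rather of its components
    that meet U, to those of U; it is a left inverse of the inclusion.  With
    excision, the Mayer-Vietoris long exact sequence of G and H breaks up into
    short ones, as the maps from the homology of U are injective.  Instead of
    setting up the long sequence, exactness is checked directly on cycles, where
    the retraction serves to correct the two parts of a cycle of X to cycles
    (lemma MVout_surj).

    Let r be minus the retraction on the homology of H.  It is a left inverse of
    the first map of the sequence, and natural for projecting decomposition maps,
    as these commute with the projections.  The section s is the one with values
    in the kernel of r, and it inherits the naturality of r (lemma split_inj). *)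

(** * Distances in a union of two graphs *)

Section Within.
Variable T : finType.
Implicit Types (G A B U X : graph T) (x y z u v : T) (p : seq T) (m n : nat).

Definition within G n x y := exists2 m, dist G x y = Some m & (m <= n)%N.

Lemma within_dist G x y n : dist G x y = Some n -> within G n x y.
Proof. by exists n. Qed.

Lemma within_path G x p : path (adj G) x p -> within G (size p) x (last x p).
Proof. exact: dist_le. Qed.

Lemma within_trans G x y z m n :
  within G m x y -> within G n y z -> within G (m + n) x z.
Proof.
move=> [a da am] [b db bn]; have [q dq qab] := dist_triangle da db.
by exists q => //; lia.
Qed.

Lemma within_le G x y m n : (m <= n)%N -> within G m x y -> within G n x y.
Proof. by move=> mn [a da am]; exists a => //; apply: leq_trans mn. Qed.

Lemma within_walk G x y n : within G n x y ->
  exists p, [/\ path (adj G) x p, last x p = y & (size p <= n)%N].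
Proof. by move=> [m /dist_path[p [pp lp sp]] mn]; exists p; rewrite sp. Qed.

Lemma within_sym G x y n : within G n x y -> within G n y x.
Proof.
move=> /within_walk[p [pp <- sp]].
have pr : path (adj G) (last x p) (rev (belast x p)).
  by rewrite rev_path; apply: sub_path pp => a b; rewrite adj_sym.
have lr : last (last x p) (rev (belast x p)) = x.
  by case: (p) => //= a q; rewrite rev_cons last_rcons.
apply: (within_le sp); have := within_path pr.
by rewrite lr size_rev size_belast.
Qed.

Lemma within_gmap (T' : finType) (G : graph T) (G' : graph T') (f : gmap G G')
    x y n : within G n x y -> exists2 m, dist G' (f x) (f y) = Some m & (m <= n)%N.
Proof.
move=> [m /(dist_gmap f)[q dq qm] mn]; exists q => //; exact: leq_trans mn.
Qed.

Lemma within_sub U X x y n : subgraph U X -> within U n x y -> within X n x y.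
Proof. by move=> UX /(within_gmap (incl UX)). Qed.

Lemma within_connect G x y n : within G n x y -> connect (adj G) x y.
Proof. by move=> /within_walk[p [pp <- _]]; apply/connectP; exists p. Qed.

Lemma connect_within G x y : connect (adj G) x y -> exists n, within G n x y.
Proof. by move=> /connectP[p pp ->]; exists (size p); apply: within_path. Qed.

(** Equality of distances reduces to two inequalities without separating the
    infinite case. *)
Lemma dist_within (A B : graph T) x y x' y' :
  (forall n, within A n x y -> within B n x' y') ->
  (forall n, within B n x' y' -> within A n x y) ->
  dist A x y = dist B x' y'.
Proof.
move=> AB BA; case dA: (dist A x y) => [m|]; case dB: (dist B x' y') => [n|] //.
- have [q + qm] := AB _ (within_dist dA); have [r + rn] := BA _ (within_dist dB).
  rewrite dA dB => -[mr] [nq]; congr Some; lia.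
- by have [q] := AB _ (within_dist dA); rewrite dB.
- by have [q] := BA _ (within_dist dB); rewrite dA.
Qed.

Lemma dist_sym G x y : dist G x y = dist G y x.
Proof. by apply: dist_within => n; apply: within_sym. Qed.

(** The first edge of the path outside A lies in B, so it starts at a vertex of
    both graphs. *)
Lemma path_exit A B x p : x \in vert A -> path (adj (graphU A B)) x p ->
  path (adj A) x p \/ exists p1 p2, [/\ p = p1 ++ p2, path (adj A) x p1,
    last x p1 \in vert A & last x p1 \in vert B].
Proof.
elim: p x => [|y p IH] x xA; first by left.
rewrite /= adj_graphU => /andP[/orP[aA|aB] pp]; last first.
  right; exists [::], (y :: p); split => //.
  by have /andP[] := adj_vert aB.
have /andP[_ yA] := adj_vert aA.
have [->|[p1 [p2 [-> pA lA lB]]]] := IH _ yA pp; first by left; rewrite aA.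
by right; exists (y :: p1), p2; split=> //=; rewrite aA.
Qed.

Lemma subgraphUl A B : subgraph A (graphU A B).
Proof. by rewrite /subgraph !subsetUl. Qed.

Lemma graphUC A B : graphU A B = graphU B A.
Proof.
have eqg (K K' : graph T) : vert K = vert K' -> edge K = edge K' -> K = K'.
  case: K K' => [a b c] [a' b' c'] /= ea eb; subst; congr Graph.
  exact: eq_irrelevance.
by apply: eqg => /=; rewrite setUC.
Qed.

(** A shortest path between two vertices of A can leave A only between two
    vertices of the intersection, where the detour through B saves nothing. *)
Lemma convex_graphU A B :
  (forall u v, u \in vert A -> u \in vert B -> v \in vert A -> v \in vert B ->
     dist A u v = dist (graphU A B) u v) -> convex A (graphU A B).
Proof.
move=> cAB x y xA yA; apply: dist_within => n.
  exact/within_sub/subgraphUl.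
move=> /within_walk[p [pp lp sp]]; apply: (within_le sp).
have [pA|[p1 [p2 [ep pA uA uB]]]] := path_exit xA pp.
  by rewrite -lp; apply: within_path.
(* u is where the path first leaves A, and v, found from the other end, where
   it last enters A. *)
set u := last x p1 in uA uB; have xu : within A (size p1) x u by exact: within_path.
rewrite ep size_cat; apply: (within_trans xu).
move: pp lp; rewrite ep cat_path last_cat => /andP[_ /within_path + lu].
rewrite lu => /within_sym/within_walk[q [pq lq sq]].
apply: (within_le sq); apply: within_sym.
have [qA|[q1 [q2 [eq' qA vA vB]]]] := path_exit yA pq.
  by rewrite -[u]lq; apply: within_path.
set v := last y q1 in vA vB; have yv : within A (size q1) y v by exact: within_path.
rewrite eq' size_cat; apply: (within_trans yv).
move: pq lq; rewrite eq' cat_path last_cat => /andP[_ /within_path + lv].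
by rewrite lv => -[m dm ms]; exists m; rewrite // cAB.
Qed.

End Within.

(** * Distances in a projecting decomposition *)

Section DecompDist.
Variable D : proj_decomp.
Local Notation X := (pd_X D).
Local Notation G := (pd_G D).
Local Notation H := (pd_H D).
Local Notation U := (pd_GH D).
Local Notation V := (pd_T D).
Implicit Types (x y h g u v : V) (s : seq V).

Lemma vert_cover x : (x \in vert G) || (x \in vert H).
Proof. by have := in_setT x; rewrite -pd_vertX pd_cover /= inE. Qed.

Lemma dist_UX u v : u \in vert U -> v \in vert U -> dist U u v = dist X u v.
Proof. exact: pd_convex. Qed.

Lemma dist_UH u v : u \in vert U -> v \in vert U -> dist U u v = dist H u v.
Proof. by have [_ + _] := pd_projects D; apply. Qed.

(** On the intersection, d_X is the distance inside the intersection, and d_G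
    lies between the two. *)
Lemma dist_GX : convex G X.
Proof.
rewrite pd_cover; apply: convex_graphU => u v uG uH vG vH.
have uU : u \in vert U by rewrite inE uG uH.
have vU : v \in vert U by rewrite inE vG vH.
rewrite -pd_cover; apply: dist_within => n.
  exact: within_sub (pd_subG D).
move=> [m dm mn]; apply: (within_sub (graphI_subl G H)).
by exists m; rewrite // dist_UX.
Qed.

Lemma dist_HX : convex H X.
Proof.
rewrite pd_cover graphUC; apply: convex_graphU => u v uH uG vH vG.
have uU : u \in vert U by rewrite inE uG uH.
have vU : v \in vert U by rewrite inE vG vH.
by rewrite -graphUC -pd_cover -dist_UH // dist_UX.
Qed.

Definition nearest (x : V) : V := proj H U x.

Lemma reachP x : reflect (x \in vert H /\ exists2 u, u \in vert U & connect (adj H) x u)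
  (x \in reach H U).
Proof. by rewrite inE; apply: (iffP andP) => -[xH /exists_inP]. Qed.

Lemma nearest_is_proj h : h \in reach H U -> is_proj H U h (nearest h).
Proof.
move=> hR; rewrite /nearest /proj; case: pickP => //= np.
have [_ _ /(_ _ hR)[p hp]] := pd_projects D.
by have /negP[] := negbT (np p).
Qed.

Lemma nearest_vert h : h \in reach H U -> nearest h \in vert U.
Proof. by move=> /nearest_is_proj/andP[]. Qed.

Lemma nearest_dist h u : h \in reach H U -> u \in vert U ->
  dist H h u = oadd (dist H h (nearest h)) (dist H (nearest h) u).
Proof. by move=> /nearest_is_proj/andP[_ /forall_inP + uU] => /(_ _ uU)/eqP. Qed.

Lemma vert_U_reach u : u \in vert U -> u \in reach H U.
Proof.
move=> uU; apply/reachP; split; last by exists u; rewrite ?connect0.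
by move: uU; rewrite inE => /andP[].
Qed.

Lemma nearest_id u : u \in vert U -> nearest u = u.
Proof.
move=> uU; have := nearest_dist (vert_U_reach uU) uU; rewrite distxx.
case d1: (dist _ _ _) => [[|a]|] //; first by rewrite -(dist0 d1).
by case: (dist _ _ _).
Qed.

(** A shortest path from h to g passes through a vertex u of the intersection,
    and its part in H may be rerouted through the projection of h, which lies on
    a geodesic from h to u. *)
Lemma dist_cross h g n : h \in vert H -> g \in vert G -> dist X h g = Some n ->
  h \in reach H U /\ dist X h g = oadd (dist X h (nearest h)) (dist X (nearest h) g).
Proof.
move=> hH gG dhg; have [p [pp lp sp]] := dist_path dhg.
have [u [a [b [uU hu ug abn]]]] : exists u a b,
    [/\ u \in vert U, within H a h u, within X b u g & (a + b = n)%N].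
  have pp' := pp; rewrite pd_cover graphUC in pp'.
  have [pH|[p1 [p2 [ep pH uH uG]]]] := path_exit hH pp'.
    exists g, n, 0%N; split => //.
    - rewrite inE gG /= -lp.
      case/lastP: (p) pH => //= q y.
      by rewrite rcons_path last_rcons => /andP[_ /adj_vert/andP[]].
    - by rewrite -lp -sp; apply: within_path.
    - by exists 0%N; rewrite ?distxx.
    - by rewrite addn0.
  exists (last h p1), (size p1), (size p2); split.
  - by rewrite inE uG uH.
  - exact: within_path.
  - by move: pp; rewrite -lp ep cat_path last_cat => /andP[_ /within_path].
  - by rewrite -size_cat -ep.
have hR : h \in reach H U.
  by apply/reachP; split => //; exists u => //; apply: within_connect hu.
split=> //; have piU := nearest_vert hR; have := nearest_dist hR uU.
have piH : nearest h \in vert H by move: piU; rewrite inE => /andP[].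
have uH : u \in vert H by move: uU; rewrite inE => /andP[].
case: hu => m dm ma; rewrite dm !dist_HX //.
case d1: (dist X h (nearest h)) => [c|] //.
case d2: (dist X (nearest h) u) => [d|] // [em].
have [q dq qle] := within_trans (within_dist d2) ug.
have [r dr rle] := within_trans (within_dist d1) (within_dist dq).
move: dr; rewrite dhg dq /= => -[er]; congr Some; lia.
Qed.

End DecompDist.

(** * Chains and their coefficients *)

Section Coefficients.
Variables (T : finType) (G : graph T) (k l : nat).
Implicit Types (s : seq T) (c d : MC G k l) (F : seq T -> int).

(** Coefficients are indexed by arbitrary sequences, so that chains of different
    graphs on the same vertices can be compared. *)
Definition coef s : MC G k l -> int :=
  lin_ext (fun t : mtuple G k l => (tval (val t) == s)%:R).
HB.instance Definition _ s := GRing.Additive.copy (coef s)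
  (lin_ext (fun t : mtuple G k l => (tval (val t) == s)%:R)).

Lemma coef_gen s s' :
  coef s' (gen G k l s) = [&& size s == k.+1, is_gen G l s & s == s']%:R.
Proof.
rewrite /coef (lin_ext_gen G (fun u => (u == s')%:R)) andbA.
by case: ifP => // _.
Qed.

Lemma chain_sum c : c = \sum_(t : mtuple G k l) gen G k l (val t) *~ c t.
Proof.
apply/ffunP => t; rewrite sum_ffunE (bigD1 t) //= big1 => [|u ut].
  by rewrite addr0 ffunMzE ffunE eqxx intz.
rewrite ffunMzE ffunE; case: eqP => [/val_inj/val_inj tu|]; last by rewrite mul0rz.
by rewrite tu eqxx in ut.
Qed.

Lemma additive_sum (W : zmodType) (A : {additive MC G k l -> W}) c :
  A c = \sum_(t : mtuple G k l) A (gen G k l (val t)) *~ c t.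
Proof.
rewrite [in LHS](chain_sum c) raddf_sum.
by apply: eq_bigr => t _; rewrite raddfMz.
Qed.

Lemma additive_ext (W : zmodType) (A B : {additive MC G k l -> W}) :
  (forall s, size s = k.+1 -> is_gen G l s -> A (gen G k l s) = B (gen G k l s)) ->
  A =1 B.
Proof.
move=> AB c; rewrite !(additive_sum _ c); apply: eq_bigr => t _.
by rewrite AB ?size_tuple ?(valP t).
Qed.

Lemma coef_val c (t : mtuple G k l) : coef (val t) c = c t.
Proof.
rewrite [c in LHS]chain_sum raddf_sum (bigD1 t) //= big1 => [|u ut].
  by rewrite addr0 raddfMz /= coef_gen size_tuple (valP t) !eqxx intz.
rewrite raddfMz /= coef_gen size_tuple (valP u) eqxx /=.
case: eqP => [/val_inj/val_inj tu|]; last by rewrite mul0rz.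
by rewrite tu eqxx in ut.
Qed.

Lemma coef_ext c d : (forall s, coef s c = coef s d) -> c = d.
Proof. by move=> cd; apply/ffunP => t; rewrite -!coef_val cd. Qed.

Lemma coef_eq0 s c : ~~ ((size s == k.+1) && is_gen G l s) -> coef s c = 0.
Proof.
move=> ns; rewrite [c]chain_sum raddf_sum big1 // => t _.
rewrite raddfMz /= coef_gen size_tuple (valP t) eqxx /=.
case: eqP => [ts|_]; last by rewrite mul0rz.
by case/negP: ns; rewrite -ts size_tuple eqxx (valP t).
Qed.

Definition chain_of F : MC G k l := [ffun t : mtuple G k l => F (tval (val t))].

Lemma coef_chain_of F s :
  coef s (chain_of F) = if (size s == k.+1) && is_gen G l s then F s else 0.
Proof.
case: ifPn => [/andP[sk gs]|]; last exact: coef_eq0.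
by rewrite (coef_val _ (Sub (Tuple sk) gs : mtuple G k l)) ffunE.
Qed.

Lemma gen_invalid s : ~~ is_gen G l s -> gen G k l s = 0.
Proof.
move=> ns; apply: coef_ext => s'; rewrite coef_gen (negPf ns) andbF.
by rewrite (raddf0 (coef s')).
Qed.

End Coefficients.

Section ConvexInclusion.
Variables (T : finType) (A B : graph T) (AB : subgraph A B) (cAB : convex A B).

Lemma length_convex s : all [in vert A] s -> length A s = length B s.
Proof.
elim: s => [|x [|y s] IH] //.
by move=> /= /andP[xA /[dup] /andP[yA _]] /IH /= ->; rewrite cAB.
Qed.

Lemma is_gen_convex l s : is_gen A l s = all [in vert A] s && is_gen B l s.
Proof.
rewrite /is_gen; case: allP => //= sA.
have -> : all [in vert B] s by apply/allP => x /sA; apply: (subsetP (proj1 (andP AB))).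
by rewrite length_convex //; apply/allP.
Qed.

Lemma coef_incl k l (c : MC A k l) s : coef s (MCmap (incl AB) c) = coef s c.
Proof.
suff /(_ c) : coef s \o @MCmap _ _ _ _ (incl AB) k l =1 coef s by [].
apply: additive_ext => u uk gu /=.
rewrite MCmap_genE //; last by left.
rewrite map_id !coef_gen gu.
by move: gu; rewrite is_gen_convex => /andP[_ ->].
Qed.

Lemma MCmap_incl_inj k l : injective (@MCmap _ _ _ _ (incl AB) k l).
Proof. by move=> c d e; apply: coef_ext => s; rewrite -!coef_incl e. Qed.

End ConvexInclusion.

Lemma MCmap_square (T1 T2 T3 T4 : finType) (G1 : graph T1) (G2 : graph T2)
    (G3 : graph T3) (G4 : graph T4) (f : gmap G1 G2) (g : gmap G2 G4)
    (f' : gmap G1 G3) (g' : gmap G3 G4) k l (c : MC G1 k l) :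
  (forall x, x \in vert G1 -> g (f x) = g' (f' x)) ->
  MCmap g (MCmap f c) = MCmap g' (MCmap f' c).
Proof.
move=> gf; suff /(_ c) : @MCmap _ _ _ _ g k l \o @MCmap _ _ _ _ f k l =1
    @MCmap _ _ _ _ g' k l \o @MCmap _ _ _ _ f' k l by [].
apply: additive_ext => s sk gs /=.
rewrite !(@MCmap_genE _ _ G1) //; [|by left|by left].
rewrite !MCmap_genE ?size_map //; [|exact: is_gen_gmap|exact: is_gen_gmap].
rewrite -!map_comp; congr gen; apply/eq_in_map => x xs.
by apply: gf; case/and3P: gs => /allP/(_ _ xs).
Qed.

Lemma MHmap_square (T1 T2 T3 T4 : finType) (G1 : graph T1) (G2 : graph T2)
    (G3 : graph T3) (G4 : graph T4) (f : gmap G1 G2) (g : gmap G2 G4)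
    (f' : gmap G1 G3) (g' : gmap G3 G4) k l (a : MH G1 k l) :
  (forall x, x \in vert G1 -> g (f x) = g' (f' x)) ->
  MHmap g (MHmap f a) = MHmap g' (MHmap f' a).
Proof.
move=> gf; rewrite -[a]homology_class_repr !MHmap_class; congr homology_class.
by apply: val_inj; apply: MCmap_square.
Qed.

(** * Inserting and deleting entries of a sequence *)

Section Insertion.
Variable T : finType.
Implicit Types (x w : T) (s : seq T) (a : pred T) (p i : nat).

Definition insert_at p w s := take p s ++ w :: drop p s.

Lemma del_insert_at p w s : (p <= size s)%N -> del p (insert_at p w s) = s.
Proof.
elim: s p => [|x s IH] [|p] //= ps; rewrite /del /insert_at /= ?drop0 //.
by move: (IH _ ps); rewrite /del /insert_at => ->.
Qed.

Lemma del_insert_at_lt i p w s : (i < p <= size s)%N ->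
  del i (insert_at p w s) = insert_at p.-1 w (del i s).
Proof.
elim: s i p => [|x s IH] i [|p]; rewrite ?andbF //=.
case: i => [|i]; first by rewrite /del /insert_at /= !drop0.
case: p => // p; rewrite !ltnS => /IH e.
by rewrite -[LHS]/(x :: del i (insert_at p.+1 w s)) e.
Qed.

Lemma del_insert_at_ge i p w s : (p <= i < size s)%N ->
  del i.+1 (insert_at p w s) = insert_at p w (del i s).
Proof.
elim: s i p => [|x s IH] i [|p]; rewrite ?andbF //.
  by rewrite /insert_at !take0 !drop0.
case: i => // i; rewrite !ltnS => /IH e.
by rewrite -[LHS]/(x :: del i.+1 (insert_at p w s)) e.
Qed.

Lemma count_del a x0 i s : (i < size s)%N ->
  count a s = (a (nth x0 s i) + count a (del i s))%N.
Proof.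
move=> si; rewrite -{1}(cat_take_drop i s) (drop_nth x0 si) /del !count_cat /=.
lia.
Qed.

Lemma has_del a x0 i s : (i < size s)%N -> ~~ a (nth x0 s i) ->
  has a (del i s) = has a s.
Proof.
by move=> si na; rewrite !has_count (count_del a x0 si) (negPf na).
Qed.

Lemma has_del_sub a i s : has a (del i s) -> has a s.
Proof.
rewrite /del has_cat => /orP[] as_.
  by rewrite -(cat_take_drop i s) has_cat as_.
by rewrite -(cat_take_drop i.+1 s) has_cat as_ orbT.
Qed.

Lemma find_del a x0 i s : (i < size s)%N -> ~~ a (nth x0 s i) ->
  find a (del i s) = (find a s - (i < find a s))%N.
Proof.
elim: s i => // x s IH [_ /=|i si /= na].
  by rewrite /del /= drop0 => /negPf ->; rewrite subn1.
by case: (a x) => //=; rewrite -/(del i s) IH // ltnS; lia.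
Qed.

Lemma nth_del x0 i q s : i != q ->
  nth x0 (del i s) (q - (i < q)) = nth x0 s q.
Proof.
elim: s i q => [|x s IH] i q; first by rewrite /del !nth_nil.
case: i q => [|i] [|q] //= iq; rewrite /del /= ?drop0 ?subn1 //.
rewrite eqSS in iq; rewrite ltnS -/(del i s) -(IH _ _ iq).
have e : (q.+1 - (i < q) = (q - (i < q)).+1)%N by case: ltngtP iq; lia.
by rewrite e.
Qed.

End Insertion.

Section DuplicateEntries.
Variables (T : finType) (G : graph T).

Lemma gen_dup k l s1 x s2 : gen G k l (s1 ++ [:: x, x & s2]) = 0.
Proof.
by apply: gen_invalid; rewrite /is_gen sorted_cat_cons /= eqxx !andbF.
Qed.

(** The two deletions of one of the equal entries cancel, and every other
    deletion keeps the repetition.  Since the boundary never deletes the end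
    entries, the cancellation needs both equal entries to be inner ones. *)
Lemma bdry_gen_dup k l s1 x s2 : size (s1 ++ [:: x, x & s2]) = k.+1 ->
  (0 < size s1)%N -> (0 < size s2)%N ->
  bdry_gen G k l (s1 ++ [:: x, x & s2]) = 0.
Proof.
set p := size s1; rewrite size_cat /= -/p => sk p0 s20.
have dlt i : (i < p)%N ->
    del i (s1 ++ [:: x, x & s2]) = del i s1 ++ [:: x, x & s2].
  move=> ip; rewrite /del takel_cat ?drop_cat -/p; last exact: ltnW.
  case: ltnP => [_|pi]; first by rewrite catA.
  have -> : (i.+1 - p = 0)%N by lia.
  by rewrite drop0 [drop i.+1 s1]drop_oversize ?cats0.
have dge i : del (p + i) (s1 ++ [:: x, x & s2]) = s1 ++ del i [:: x, x & s2].
  rewrite /del take_cat drop_cat -/p ltnNge leq_addr /= addKn -addnS.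
  by rewrite ltnNge leq_addr /= addKn catA.
rewrite /bdry_gen (@big_cat_nat _ _ _ p) //=; last by lia.
rewrite big_nat big1 => [|i /andP[_ ip]]; last by rewrite dlt // gen_dup mul0rz.
rewrite add0r big_ltn; last by lia.
rewrite big_ltn; last by lia.
rewrite big_nat big1 => [|i /andP[pi ik]]; last first.
  have -> : i = (p + (i - p.+2).+2)%N by lia.
  by rewrite dge /del /= gen_dup mul0rz.
have e0 : del p (s1 ++ [:: x, x & s2]) = s1 ++ x :: s2.
  by have := dge 0%N; rewrite addn0.
have e1 : del p.+1 (s1 ++ [:: x, x & s2]) = s1 ++ x :: s2.
  by have := dge 1%N; rewrite addn1 => ->; rewrite /del /= ?drop0.
by rewrite addr0 e0 e1 exprS mulN1r mulrNz addrN.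
Qed.

End DuplicateEntries.

(** * The first crossing between the two sides *)

Section Crossing.
Variable D : proj_decomp.
Local Notation X := (pd_X D).
Local Notation G := (pd_G D).
Local Notation H := (pd_H D).
Local Notation U := (pd_GH D).
Local Notation V := (pd_T D).
Implicit Types (x y h g u v w : V) (s : seq V) (i k l n : nat).

Definition honly x := x \notin vert G.
Definition gonly x := x \notin vert H.
Definition outer x := honly x || gonly x.
Definition mixed s := has honly s && has gonly s.

Lemma honly_in x : honly x -> x \in vert H.
Proof. by move=> hx; have := vert_cover x; rewrite (negPf hx). Qed.

Lemma honly_gonly x : honly x -> gonly x = false.
Proof. by move/honly_in => xH; apply/negbTE; rewrite negbK. Qed.

Lemma outer_U x : x \in vert U -> outer x = false.
Proof. by rewrite inE /outer /honly /gonly => /andP[-> ->]. Qed.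

(** The number of entries up to and including the last vertex outside G that
    comes before the first vertex outside H; it is 0 if there is none. *)
Fixpoint last_h s :=
  if s is x :: s' then
    if gonly x then 0%N
    else if honly x || (0 < last_h s')%N then (last_h s').+1 else 0%N
  else 0%N.

(** The insertion takes place at the first passage between the two sides, next
    to its vertex h outside G: just after h if the passage goes from H to G, and
    just before h if it goes from G to H, which is the case last_h s = 0.  The
    inserted vertex is the projection of h. *)
Definition ins_pos s := if last_h s == 0%N then find honly s else last_h s.
Definition ins_pt x0 s :=
  nearest (nth x0 s (if last_h s == 0%N then find honly s else (last_h s).-1)).
Definition ins s := if s is x0 :: _ then insert_at (ins_pos s) (ins_pt x0 s) s else s.

Lemma last_h_split s : (0 < last_h s)%N -> has gonly s ->
  exists s1 u v s2, [/\ s = s1 ++ [:: u, v & s2], last_h s = (size s1).+1,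
    honly u, ~~ honly v & has gonly (v :: s2)].
Proof.
elim: s => // x s IH; rewrite [last_h _]/= [has _ _]/=.
case: ifP => // /negbT gx; case: ifP => //= hx _ gs.
case: (posnP (last_h s)) => [l0|l1]; last first.
  have [s1 [u [v [s2 [e el hu hv gv]]]]] := IH l1 gs.
  by exists (x :: s1), u, v, s2; rewrite e /= -el -e.
rewrite l0 orbF in hx *; case: s l0 gs {IH} => // v s2 l0 gv.
exists [::], x, v, s2; split => //; apply/negP => hv.
by move: l0; rewrite /= (honly_gonly hv) hv.
Qed.

Lemma find_h_split x s : ~~ honly x -> has honly s ->
  exists s1 u v s2, [/\ x :: s = s1 ++ [:: u, v & s2],
    find honly (x :: s) = (size s1).+1, ~~ honly u, honly v & x \in rcons s1 u].
Proof.
elim: s x => [//=|y s IH] x hx; rewrite [has _ _]/= //.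
case: (boolP (honly y)) => [hy _|hy /= hs].
  exists [::], x, y, s; split => //; rewrite ?mem_seq1 ?eqxx //.
  by rewrite /= (negPf hx) hy.
have [s1 [u [v [s2 [e el hu hv _]]]]] := IH y hy hs.
exists (x :: s1), u, v, s2; rewrite mem_head; split=> //; first by rewrite e.
by rewrite -[RHS]/(size s1).+2 -el [LHS]/= (negPf hx).
Qed.

Lemma first_h_split s : last_h s = 0%N -> has honly s ->
  exists s1 u v s2, [/\ s = s1 ++ [:: u, v & s2], find honly s = (size s1).+1,
    ~~ honly u, honly v & has gonly (rcons s1 u)].
Proof.
elim: s => // x s IH; rewrite [last_h _]/=; case: ifP => [gx _|gx].
  have nhx : ~~ honly x by apply: contraL gx => /honly_gonly ->.
  rewrite [has _ _]/= (negPf nhx) => /(find_h_split nhx).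
  move=> [s1 [u [v [s2 [e el hu hv xu]]]]]; exists s1, u, v, s2; split => //.
  by apply/hasP; exists x.
case: ifP => // /negbT; rewrite negb_or -eqn0Ngt => /andP[hx /eqP l0] _.
rewrite [has _ _]/= (negPf hx) /= => /(IH l0).
move=> [s1 [u [v [s2 [e el hu hv xu]]]]]; exists (x :: s1), u, v, s2.
split=> //; [by rewrite e|by rewrite /= (negPf hx) el|by rewrite /= xu orbT].
Qed.

Lemma dist_HG u v n : honly u -> v \in vert G -> dist X u v = Some n ->
  nearest u \in vert U /\ dist X u v = oadd (dist X u (nearest u)) (dist X (nearest u) v).
Proof.
by move=> /honly_in uH vG /(dist_cross uH vG)[/nearest_vert uU].
Qed.

Lemma dist_GH u v n : u \in vert G -> honly v -> dist X u v = Some n ->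
  nearest v \in vert U /\ dist X u v = oadd (dist X u (nearest v)) (dist X (nearest v) v).
Proof.
rewrite dist_sym => uG hv /(dist_HG hv uG)[? ->]; split => //.
rewrite (dist_sym X u (nearest v)) (dist_sym X (nearest v) v).
by case: dist => [a|]; case: dist => [b|] //=; rewrite addnC.
Qed.

Lemma length_crossing s1 u v s2 n : length X (s1 ++ [:: u, v & s2]) = Some n ->
  exists m, dist X u v = Some m.
Proof.
rewrite length_cat; case: (length X (rcons s1 u)) => // a.
rewrite [length X _]/= -/(length X (v :: s2)).
by case: dist => // m _; exists m.
Qed.

(** The last two clauses say that a repetition created by the insertion never
    involves an end of the tuple: if w = u then u lies in the intersection, so the
    vertex outside H that starts the passage comes before u; symmetrically if
    w = v. *)
Lemma ins_spec s n : mixed s -> length X s = Some n ->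
  exists s1 u v s2 w,
    [/\ s = s1 ++ [:: u, v & s2], ins_pos s = (size s1).+1,
        ins s = s1 ++ [:: u, w, v & s2], w \in vert U &
        [/\ dist X u v = oadd (dist X u w) (dist X w v),
            w = u -> (0 < size s1)%N & w = v -> (0 < size s2)%N]].
Proof.
move=> /andP[hs gs] ls; case: (posnP (last_h s)) => [l0|l1].
  have [s1 [u [v [s2 [e el hu hv gu]]]]] := first_h_split l0 hs.
  have [m duv] := length_crossing (etrans (esym (congr1 _ e)) ls).
  have uG : u \in vert G by move: hu; rewrite negbK.
  have [piU dpi] := dist_GH uG hv duv.
  exists s1, u, v, s2, (nearest v); split => //.
  - by rewrite /ins_pos l0.
  - have -> : ins s = insert_at (ins_pos s) (ins_pt u s) s.
      rewrite /ins; case es: (s) => [|y s'].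
        by case: (s1) (etrans (esym e) es).
      rewrite -es; congr insert_at.
      by rewrite /ins_pt l0 el e !nth_cat /= ltnNge leqnSn /= subSnn.
    rewrite /ins_pt /ins_pos l0 el e /insert_at nth_cat /= ltnNge leqnSn /= subSnn /=.
    by rewrite take_cat drop_cat ltnNge leqnSn /= subSnn /= ?take0 ?drop0 -catA.
  split => //.
    move=> pu; case: (s1) gu => //=; rewrite orbF -pu => gv.
    by move: (outer_U piU); rewrite /outer gv orbT.
  by move=> pv; move: (outer_U piU); rewrite /outer pv hv.
have [s1 [u [v [s2 [e el hu hv gv]]]]] := last_h_split l1 gs.
have [m duv] := length_crossing (etrans (esym (congr1 _ e)) ls).
have vG : v \in vert G by move: hv; rewrite negbK.
have [piU dpi] := dist_HG hu vG duv.
have ln0 : last_h s == 0%N = false by apply/negbTE; rewrite -lt0n.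
exists s1, u, v, s2, (nearest u); split => //.
- by rewrite /ins_pos ln0.
- have -> : ins s = insert_at (ins_pos s) (ins_pt u s) s.
    rewrite /ins; case es: (s) => [|y s'].
      by case: (s1) (etrans (esym e) es).
    rewrite -es; congr insert_at.
    by rewrite /ins_pt ln0 el e !nth_cat /= ltnn subnn.
  rewrite /ins_pt /ins_pos ln0 el e /insert_at nth_cat /= ltnn subnn /=.
  by rewrite take_cat drop_cat ltnNge leqnSn /= subSnn /= ?take0 ?drop0 -catA.
split => //.
  by move=> pu; move: (outer_U piU); rewrite /outer pu hu.
move=> pv; case: (s2) gv => //=; rewrite orbF -pv => gu.
by move: (outer_U piU); rewrite /outer gu orbT.
Qed.

Lemma length_ins s n : mixed s -> length X s = Some n -> length X (ins s) = Some n.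
Proof.
move=> ms ls; have [s1 [u [v [s2 [w [e _ -> _ [d _ _]]]]]]] := ins_spec ms ls.
rewrite -ls e !(length_cat _ u); congr oadd.
rewrite /= -!/(length X (v :: s2)) d.
case: (dist X u w) => // a; case: (dist X w v) => // b.
by case: (length X (v :: s2)) => //= c; rewrite addnA.
Qed.

Lemma size_ins s n : mixed s -> length X s = Some n -> size (ins s) = (size s).+1.
Proof.
move=> ms ls; have [s1 [u [v [s2 [w [-> _ -> _ _]]]]]] := ins_spec ms ls.
by rewrite !size_cat /= addnS.
Qed.

Lemma count_outer_ins s n : mixed s -> length X s = Some n ->
  count outer (ins s) = count outer s.
Proof.
move=> ms ls; have [s1 [u [v [s2 [w [-> _ -> wU _]]]]]] := ins_spec ms ls.
by rewrite !count_cat /= (outer_U wU).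
Qed.

(** The induction needs the positivity clause, since last_h counts a leading entry
    of the intersection only if it is positive on the rest. *)
Lemma last_h_del x0 i s : (i < size s)%N -> ~~ outer (nth x0 s i) ->
  last_h (del i s) = (last_h s - (i < last_h s))%N /\
  (0 < last_h (del i s))%N = (0 < last_h s)%N.
Proof.
rewrite /outer; elim: s i => // x s IH [_|i si].
  rewrite [nth _ _ _]/= negb_or /del /= drop0 => /andP[/negPf-> /negPf->] /=.
  by case: (last_h s) => //= q; rewrite subn1.
rewrite [nth _ _ _]/= => ni; have [e1 e2] := IH i si ni.
rewrite -[del _ _]/(x :: del i s) [last_h (x :: s)]/= [last_h (x :: del _ _)]/= e2.
case: ifP => // gx; case: ifP => // hx; split=> //; rewrite e1 ltnS.
by case: ltnP => //; lia.
Qed.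

Lemma nth_last_h x0 s : (0 < last_h s)%N -> honly (nth x0 s (last_h s).-1).
Proof.
elim: s => // x s IH; rewrite [last_h _]/=; case: ifP => // _; case: ifP => // hx _.
by move: hx; case: (last_h s) IH => [|n] IH /=; rewrite ?orbF // => _; apply: IH.
Qed.

Lemma mixed_del x0 i s : (i < size s)%N -> ~~ outer (nth x0 s i) ->
  mixed (del i s) = mixed s.
Proof.
move=> si; rewrite negb_or => /andP[h g].
by rewrite /mixed !(has_del si (x0 := x0)).
Qed.

Lemma ins_pos_del x0 i s : mixed s -> (i < size s)%N -> ~~ outer (nth x0 s i) ->
  ins_pos (del i s) = (ins_pos s - (i < ins_pos s))%N /\
  ins_pt x0 (del i s) = ins_pt x0 s.
Proof.
move=> ms si ni; have [e1 e2] := last_h_del si ni.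
have /norP[nh ng] := ni; rewrite /ins_pos /ins_pt !eqn0Ngt e2 -!eqn0Ngt.
case: posnP => l0 /=.
  rewrite (find_del si nh); split => //; rewrite nth_del //.
  apply: contraNneq nh => ->; apply: nth_find; by case/andP: ms.
have iq : i != (last_h s).-1.
  by apply: contraNneq nh => ->; apply: nth_last_h.
rewrite e1; split => //; rewrite -[in RHS](nth_del _ _ iq).
by congr (nearest (nth _ _ _)); move/eqP: iq; case: ltnP; case: ltnP; lia.
Qed.

(** The place and the vertex of the insertion depend only on the entries outside
    the intersection. *)
Lemma ins_del x0 i s n : mixed s -> length X s = Some n -> (0 < i < size s)%N ->
  ~~ outer (nth x0 s i) ->
  ins (del i s) =
    (if (i < ins_pos s)%N then del i (ins s) else del i.+1 (ins s)).
Proof.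
move=> ms ls /andP[i0 si] ni.
have ps : (ins_pos s <= size s)%N.
  have [s1 [u [v [s2 [w [-> -> _ _ _]]]]]] := ins_spec ms ls.
  by rewrite size_cat /=; lia.
case: s ms ls si ni ps => // y s ms ls si ni ps.
rewrite (set_nth_default y) // in ni.
have [e1 e2] := ins_pos_del ms si ni.
have -> : ins (del i (y :: s)) =
    insert_at (ins_pos (del i (y :: s))) (ins_pt y (del i (y :: s))) (del i (y :: s)).
  by case: (i) i0.
rewrite e1 e2; case: ltnP => ip.
  by rewrite subn1 del_insert_at_lt ?ip.
by rewrite subn0 del_insert_at_ge ?ip.
Qed.

End Crossing.

(** * The insertion homotopy *)

Section Contraction.
Variable D : proj_decomp.
Local Notation X := (pd_X D).
Local Notation G := (pd_G D).
Local Notation H := (pd_H D).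
Local Notation U := (pd_GH D).
Local Notation V := (pd_T D).
Implicit Types (x y h g u v w : V) (s : seq V) (i k l n : nat).

(** The sign is the one with which the inserted entry is deleted again by the
    boundary. *)
Definition insert_chain k l : MC X k l -> MC X k.+1 l :=
  lin_ext (fun t : mtuple X k l =>
    if mixed (val t) then gen X k.+1 l (ins (val t)) *~ (-1) ^+ ins_pos (val t) else 0).
HB.instance Definition _ k l := GRing.Additive.copy (@insert_chain k l)
  (lin_ext (fun t : mtuple X k l =>
    if mixed (val t) then gen X k.+1 l (ins (val t)) *~ (-1) ^+ ins_pos (val t) else 0)).

(** The two possibilities for a tuple obtained from a generating one by
    deleting an inner entry. *)
Definition valid_or_short l s :=
  is_gen X l s \/ (exists2 n, length X s = Some n & (n < l)%N).

Lemma insert_gen k l s : size s = k.+1 -> valid_or_short l s ->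
  insert_chain (gen X k l s) =
  if mixed s then gen X k.+1 l (ins s) *~ (-1) ^+ ins_pos s else 0.
Proof.
move=> sk vs; rewrite /insert_chain (lin_ext_gen X (fun s => if mixed s then
  gen X k.+1 l (ins s) *~ (-1) ^+ ins_pos s else 0)) sk eqxx /=.
case: ifPn => // ngs; case: vs => [gs|[n ln nl]]; first by rewrite gs in ngs.
case: ifP => // ms; rewrite gen_length ?mul0rz // (length_ins ms ln).
by apply/eqP => -[]; lia.
Qed.

Definition outer_below n k l (c : MC X k l) :=
  forall s, (n <= count (@outer D) s)%N -> coef s c = 0.

Lemma outer_belowD n k l (c d : MC X k l) :
  outer_below n c -> outer_below n d -> outer_below n (c + d).
Proof. by move=> nc nd s ns; rewrite raddfD /= nc ?nd. Qed.

Lemma outer_below_sum n k l (I : Type) (r : seq I) (P : pred I) (F : I -> MC X k l) :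
  (forall j, P j -> outer_below n (F j)) -> outer_below n (\sum_(j <- r | P j) F j).
Proof. by move=> nF s ns; rewrite raddf_sum big1 // => j Pj; apply: nF. Qed.

Lemma outer_below_mulz n k l (c : MC X k l) z : outer_below n c -> outer_below n (c *~ z).
Proof. by move=> nc s ns; rewrite raddfMz /= nc // mul0rz. Qed.

Lemma outer_below_gen n k l s : (count (@outer D) s < n)%N ->
  outer_below n (gen X k l s).
Proof.
move=> sn s' ns; rewrite coef_gen; suff /negPf-> : s != s' by rewrite !andbF.
by apply: contraL ns => /eqP <-; rewrite -ltnNge.
Qed.

Lemma is_gen_ins l s s1 u w v s2 : is_gen X l s ->
  s = s1 ++ [:: u, v & s2] -> w != u -> w != v ->
  length X (s1 ++ [:: u, w, v & s2]) = Some l -> is_gen X l (s1 ++ [:: u, w, v & s2]).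
Proof.
move=> /and3P[_ so _] es wu wv ls; rewrite /is_gen ls eqxx andbT; apply/andP; split.
  by apply/allP => x _; rewrite pd_vertX in_setT.
move: so; rewrite es !sorted_cat_cons /= => /andP[-> /andP[_ ->]].
by rewrite eq_sym wu wv.
Qed.

(** Deleting the inserted entry gives back s.  Deleting another entry of the
    intersection commutes with the insertion, up to a shift of the position that
    reverses the sign, so these terms cancel.  Deleting an entry outside the
    intersection lowers the number of such entries. *)
Lemma insert_homotopy k l s : size s = k.+2 -> is_gen X l s -> mixed s ->
  outer_below (count (@outer D) s)
    (bdry X k.+2 l (insert_chain (gen X k.+1 l s))
     + insert_chain (bdry X k.+1 l (gen X k.+1 l s)) - gen X k.+1 l s).
Proof.
move=> sk gs ms; set N := count _ s.
have /and3P[_ _ /eqP ls] := gs.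
have [s1 [u [v [s2 [w [es ps ei wU [_ wu wv]]]]]]] := ins_spec ms ls.
(* If w is already a neighbour, ins s is not a generating tuple; both sides are
   then 0. *)
have bS : bdry X k.+2 l (gen X k.+2 l (ins s)) = bdry_gen X k.+2 l (ins s).
  have szi : size (ins s) = k.+3 by rewrite (size_ins ms ls) sk.
  have li := length_ins ms ls.
  have [uw|wnu] := eqVneq w u.
    rewrite ei uw gen_dup raddf0 bdry_gen_dup ?wu //.
    by rewrite -szi ei uw.
  have [vw|wnv] := eqVneq w v.
    have e : s1 ++ [:: u, v, v & s2] = rcons s1 u ++ [:: v, v & s2].
      by rewrite cat_rcons.
    rewrite ei vw e gen_dup raddf0 bdry_gen_dup ?wv ?size_rcons //.
    by rewrite -szi ei vw e.
  apply: bdryE => //; left; rewrite ei; apply: is_gen_ins es _ _ _ => //.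
  by rewrite -ei.
have p0 : (0 < ins_pos s)%N by rewrite ps.
have pk : (ins_pos s < k.+2)%N by rewrite ps -sk es size_cat /=; lia.
have psz : (ins_pos s <= size s)%N by rewrite sk ltnW.
rewrite insert_gen //; last by left.
rewrite ms raddfMz /= bS bdryE //; last by left.
rewrite /bdry_gen raddf_sum mulrz_suml.
(* C i is the term of insert_chain (bdry s) from the deletion of the i-th entry
   of s, and E i the term of bdry (insert_chain s) from that of the same entry. *)
pose x0 := u.
pose B i := gen X k.+1 l (del i (ins s)) *~ (-1) ^+ i *~ (-1) ^+ ins_pos s.
pose C i := insert_chain (gen X k l (del i s) *~ (-1) ^+ i).
pose E i := gen X k.+1 l (del (if (i < ins_pos s)%N then i else i.+1) (ins s))
  *~ (-1) ^+ (if (i < ins_pos s)%N then i else i.+1) *~ (-1) ^+ ins_pos s.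
have dp : del (ins_pos s) (ins s) = s.
  have -> : ins s = insert_at (ins_pos s) w s.
    by rewrite ei /insert_at ps es take_cat drop_cat ltnNge leqnSn /= subSnn /=
      ?take0 ?drop0 -catA.
  exact: del_insert_at.
have split_sum : \sum_(1 <= i < k.+2) B i = \sum_(1 <= i < k.+1) E i + gen X k.+1 l s.
  rewrite (@big_cat_nat _ _ _ (ins_pos s)) //=; last exact: ltnW.
  rewrite [X in _ + X]big_ltn // addrCA [RHS]addrC; congr (_ + _).
    by rewrite /B dp -mulrzA -expr2 sqrr_sign mulr1z.
  rewrite [RHS](@big_cat_nat _ _ _ (ins_pos s)) //=; congr (_ + _).
    by apply: eq_big_nat => i /andP[_ ip]; rewrite /E ip.
  rewrite big_add1 /=; apply: eq_big_nat => i /andP[pi _].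
  by rewrite /E ltnNge pi.
have key i : (0 < i < k.+1)%N -> outer_below N (E i + C i).
  move=> /andP[i0 ik]; have isz : (i < size s)%N by rewrite sk ltnS ltnW.
  have vd : valid_or_short l (del i s).
    by apply: is_gen_del => //; rewrite sk.
  have sd : size (del i s) = k.+1 by rewrite size_del // sk.
  rewrite /C raddfMz /= insert_gen //.
  have [ni|oi] := boolP (outer (nth x0 s i)).
    apply: outer_belowD; last first.
      apply: outer_below_mulz; case: ifP => md; last by move=> ? _; rewrite raddf0.
      apply/outer_below_mulz/outer_below_gen.
      have [n ln] : exists n, length X (del i s) = Some n.
        case: vd => [/and3P[_ _ /eqP]|[n]]; [by exists l|by exists n].
      rewrite (count_outer_ins md ln) /N (count_del (@outer D) x0 isz) ni.
      exact: ltnSn.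
    do 2 apply: outer_below_mulz; apply: outer_below_gen.
    (* j is the position in ins s of the i-th entry of s. *)
    set j := if _ then _ else _.
    have jsz : (j < size (ins s))%N by rewrite (size_ins ms ls) /j; case: ifP; lia.
    suff oj : outer (nth x0 (ins s) j).
      have := count_del (@outer D) x0 jsz.
      by rewrite (count_outer_ins ms ls) oj -/N; lia.
    have nthi : nth x0 (ins s) j = nth x0 s i.
      have jp : ins_pos s != j by rewrite /j; case: ltnP => h; apply/eqP; lia.
      rewrite -(nth_del x0 (ins s) jp) dp; congr (nth _ _ _).
      by rewrite /j; case: ltnP => h; case: ltnP; lia.
    by rewrite nthi.
  have md : mixed (del i s) by rewrite (mixed_del isz oi).
  have [ep _] := ins_pos_del ms isz oi.
  rewrite md ep (ins_del (x0 := x0) ms ls) ?i0 // /E => s' _.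
  case: ltnP => ip.
    have -> : (-1) ^+ (ins_pos s) = - (-1) ^+ (ins_pos s - 1) :> int.
      by rewrite -{1}(subnKC p0) add1n exprS mulN1r.
    by rewrite mulrNz -!mulrzA mulrC addNr raddf0.
  by rewrite subn0 exprS mulN1r mulrNz mulNrz -!mulrzA mulrC addNr raddf0.
rewrite split_sum addrAC addrK -big_split /= big_nat.
by apply: outer_below_sum => i /key.
Qed.

End Contraction.

(** * Excision *)

Section Excision.
Variable D : proj_decomp.
Local Notation X := (pd_X D).
Local Notation G := (pd_G D).
Local Notation H := (pd_H D).
Local Notation U := (pd_GH D).
Local Notation V := (pd_T D).
Implicit Types (x y h g u v w : V) (s : seq V) (i k l n : nat).

Definition nonmixed k l (c : MC X k l) := forall s, mixed s -> coef s c = 0.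

Lemma nonmixedB k l (c d : MC X k l) : nonmixed c -> nonmixed d -> nonmixed (c - d).
Proof. by move=> nc nd s ms; rewrite raddfB /= nc ?nd ?subr0. Qed.

Lemma nonmixed_bdry k l (c : MC X k l) : nonmixed c -> nonmixed (bdry X k l c).
Proof.
move=> nc s ms; rewrite (chain_sum c) (raddf_sum (bdry X k l)) raddf_sum big1 // => t _.
rewrite (raddfMz (bdry X k l)) raddfMz -(coef_val c t).
have [mt|nmt] := boolP (mixed (val t)).
  by rewrite nc // mulr0z.
rewrite /= bdryE ?size_tuple //; last by left; exact: (valP t).
rewrite /bdry_gen (raddf_sum (coef s)) big1 ?mul0rz // => i _.
rewrite (raddfMz (coef s)) /= coef_gen.
case: (_ =P s) => [e|_]; last by rewrite !andbF mul0rz.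
case/negP: nmt; move: ms; rewrite -e => /andP[hs gs].
by rewrite /mixed (has_del_sub hs) (has_del_sub gs).
Qed.

Lemma insert_nonmixed k l (c : MC X k l) : nonmixed c -> insert_chain c = 0.
Proof.
move=> nc; rewrite /insert_chain /lin_ext big1 // => t _.
by case: ifP => mt; rewrite ?mul0rz // -(coef_val c t) nc // mulr0z.
Qed.

(** The subcomplex of nonmixed chains carries all of the homology.  Subtracting
    the boundary of insert_chain z from z lowers the largest number of entries
    outside the intersection among the mixed tuples of z, and this is iterated
    until no mixed tuple is left. *)
Lemma excision k l (z : MC X k l) : nonmixed (bdry X k l z) ->
  exists w : MC X k.+1 l, nonmixed (z - bdry X k.+1 l w).
Proof.
case: k z => [|k] z nbz.
  exists 0; rewrite raddf0 subr0 => s /andP[hs gs]; apply: coef_eq0.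
  apply/negP => /andP[/eqP]; case: s hs gs => [|x [|y s]] //=.
  by rewrite !orbF => /honly_gonly ->.
have [n zn] : exists n, forall s, mixed s -> (n <= count (@outer D) s)%N -> coef s z = 0.
  exists k.+3 => s _ ns; apply: coef_eq0; apply/negP => /andP[/eqP sk _].
  by move: (count_size (@outer D) s); rewrite sk; lia.
elim: n z nbz zn => [|n IH] z nbz zn.
  by exists 0; rewrite raddf0 subr0 => s ms; apply: zn.
pose z1 : MC X k.+1 l := chain_of X k.+1 l (fun s => if mixed s then coef s z else 0).
have coef1 s : coef s z1 = if mixed s then coef s z else 0.
  rewrite coef_chain_of; case: ifPn => // ns.
  by rewrite coef_eq0 //; case: ifP.
have nz0 : nonmixed (z - z1).
  by move=> s ms; rewrite raddfB /= coef1 ms subrr.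
have nbz1 : nonmixed (bdry X k.+1 l z1).
  have -> : z1 = z - (z - z1) by rewrite opprB addrC subrK.
  by rewrite raddfB; apply: nonmixedB nbz _; apply: nonmixed_bdry nz0.
pose A (c : MC X k.+1 l) :=
  bdry X k.+2 l (insert_chain c) + insert_chain (bdry X k.+1 l c) - c.
have low : outer_below n (A z1).
  have -> : A z1 = \sum_(t : mtuple X k.+1 l) A (gen X k.+1 l (val t)) *~ z1 t.
    have e1 : bdry X k.+2 l (insert_chain z1) = _ :=
      additive_sum (bdry X k.+2 l \o @insert_chain D k.+1 l) z1.
    have e2 : insert_chain (bdry X k.+1 l z1) = _ :=
      additive_sum (@insert_chain D k l \o bdry X k.+1 l) z1.
    rewrite /A e1 e2 [X in _ - X]chain_sum.
    by rewrite -big_split -sumrB; apply: eq_bigr => t _; rewrite mulrzBl mulrzDl.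
  apply: outer_below_sum => t _; rewrite -(coef_val z1 t) coef1.
  case: ifP => mt; last first.
    by move=> s _; rewrite mulr0z raddf0.
  have [nt|nt] := leqP n.+1 (count (@outer D) (val t)).
    by move=> s _; rewrite zn // mulr0z raddf0.
  apply: outer_below_mulz => s ns; apply: insert_homotopy mt _ _.
  - by rewrite size_tuple.
  - exact: (valP t).
  - exact: leq_trans ns.
have Ez : z - bdry X k.+2 l (insert_chain z1) = (z - z1) - A z1.
  by rewrite /A (insert_nonmixed nbz1) addr0 opprB addrA subrK.
have [||w nw] := IH (z - bdry X k.+2 l (insert_chain z1)).
- have /= bb := @bdry_bdry _ X k.+2 l (insert_chain z1).
  by rewrite (raddfB (bdry X k.+1 l)) /= bb subr0.
- by move=> s ms ns; rewrite Ez raddfB /= nz0 // low // subr0.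
by exists (insert_chain z1 + w); rewrite raddfD opprD addrA.
Qed.

Lemma convex_UG : convex U G.
Proof.
move=> u v uU vU; rewrite dist_UX //; move: uU vU.
rewrite !inE => /andP[uG _] /andP[vG _].
by rewrite dist_GX.
Qed.

Lemma convex_UH : convex U H.
Proof. exact: dist_UH. Qed.

Lemma all_vertU s : all [in vert U] s = all [in vert G] s && all [in vert H] s.
Proof. by rewrite -all_predI; apply: eq_all => x; rewrite /= inE. Qed.

(** A tuple with a nonzero coefficient in a has one in b as well, hence lies in
    both graphs. *)
Lemma chain_exact_mid k l (a : MC G k l) (b : MC H k l) :
  MCmap (pd_iG D) a + MCmap (pd_iH D) b = 0 ->
  exists c : MC U k l, a = MCmap (pd_jG D) c /\ b = - MCmap (pd_jH D) c.
Proof.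
move=> ab0; have abs s : coef s a + coef s b = 0.
  rewrite -(coef_incl (pd_subG D) (@dist_GX D)) -(coef_incl (pd_subH D) (@dist_HX D)).
  by rewrite -raddfD ab0 raddf0.
exists (chain_of U k l (fun s => coef s a)).
suff cs s : coef s (chain_of U k l (fun s => coef s a)) = coef s a.
  split; apply: coef_ext => s.
    by rewrite (coef_incl _ convex_UG) cs.
  by rewrite raddfN /= (coef_incl _ convex_UH) cs; apply/eqP; rewrite -addr_eq0 addrC abs.
rewrite coef_chain_of; case: ifPn => // ns; apply/esym/eqP.
apply: contraNT ns => as0; have : coef s b != 0.
  by apply: contraNneq as0 => b0; move: (abs s); rewrite b0 addr0 => ->.
move=> bs0; have /andP[-> gG] : (size s == k.+1) && is_gen G l s.
  by apply: contraNT as0 => /coef_eq0 ->.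
have /andP[_ gH] : (size s == k.+1) && is_gen H l s.
  by apply: contraNT bs0 => /coef_eq0 ->.
move: gG gH; rewrite (is_gen_convex (pd_subG D) (@dist_GX D)).
rewrite (is_gen_convex (pd_subH D) (@dist_HX D)).
rewrite (is_gen_convex (graphI_subl G H) convex_UG).
rewrite (is_gen_convex (pd_subG D) (@dist_GX D)) all_vertU.
by move=> /andP[-> ->] /andP[-> _].
Qed.

Lemma nonmixed_split k l (z : MC X k l) : nonmixed z ->
  exists (a : MC G k l) (b : MC H k l), z = MCmap (pd_iG D) a + MCmap (pd_iH D) b.
Proof.
move=> nz; exists (chain_of G k l (fun s => coef s z)).
(* Tuples of the intersection are counted in G only. *)
exists (chain_of H k l (fun s => if all [in vert G] s then 0 else coef s z)).
apply: coef_ext => s; rewrite raddfD /=.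
rewrite (coef_incl _ (@dist_GX D)) (coef_incl _ (@dist_HX D)) !coef_chain_of.
rewrite (is_gen_convex (pd_subG D) (@dist_GX D)) (is_gen_convex (pd_subH D) (@dist_HX D)).
have [/andP[-> ->]|ns] := boolP ((size s == k.+1) && is_gen X l s); last first.
  by rewrite (coef_eq0 _ ns); do 3 case: ifP => //.
rewrite !andbT /=; case: ifPn => aG; first by rewrite if_same addr0.
case: ifPn => aH; first by rewrite add0r.
by rewrite nz ?addr0 // /mixed !has_predC aG aH.
Qed.

End Excision.

(** * Chain maps and homology *)

Lemma homology_class_eq (T : finType) (K : graph T) k l (y z : cycle K k l) c :
  val y - val z = bdry K k.+1 l c -> homology_class y = homology_class z.
Proof.
move=> yz; apply/eqP; rewrite -subr_eq0 -raddfB homology_class_eq0.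
by apply/asboolP; exists c.
Qed.

Section ChainMap.
Variables (T T' : finType) (G : graph T) (G' : graph T') (l : nat).
Variable phi : forall k, {additive MC G k l -> MC G' k l}.
Hypothesis phiB : forall k c, bdry G' k l (phi k c) = phi k.-1 (bdry G k l c).
Variable k : nat.

Lemma chain_map_cycle (z : cycle G k l) : is_cycle (phi k (val z)).
Proof. by rewrite /is_cycle phiB (eqP (valP z)) raddf0. Qed.

Definition MHinduced (a : MH G k l) : MH G' k l :=
  homology_class (Cycle (chain_map_cycle (repr a))).

Lemma MHinduced_class z :
  MHinduced (homology_class z) = homology_class (Cycle (chain_map_cycle z)).
Proof.
apply/eqP; rewrite -subr_eq0 -raddfB homology_class_eq0; apply/asboolP.
have : is_boundary (repr (homology_class z) - z).
  by rewrite -homology_class_eq0 raddfB /= homology_class_repr subrr.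
move=> /asboolP[c rzc]; exists (phi k.+1 c).
by rewrite phiB /= -rzc !raddfB.
Qed.

Lemma MHinduced_is_zmod_morphism : zmod_morphism MHinduced.
Proof.
move=> a b; rewrite -[a]homology_class_repr -[b]homology_class_repr.
rewrite -raddfB !MHinduced_class -raddfB; congr homology_class.
by apply: val_inj; rewrite /= !raddfB.
Qed.
End ChainMap.

HB.instance Definition _ T T' G G' l phi phiB k := GRing.isZmodMorphism.Build _ _
  (@MHinduced T T' G G' l phi phiB k)
  (@MHinduced_is_zmod_morphism T T' G G' l phi phiB k).

(** * The retraction given by projecting *)

Section Retraction.
Variable D : proj_decomp.
Local Notation X := (pd_X D).
Local Notation G := (pd_G D).
Local Notation H := (pd_H D).
Local Notation U := (pd_GH D).
Local Notation V := (pd_T D).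
Implicit Types (x y h g u v w : V) (s : seq V) (i k l n : nat).

Lemma reach_graph_subproof :
  [forall e in [set e in edge H | e \subset reach H U],
     (e \subset reach H U) && (#|e| == 2)].
Proof.
apply/forall_inP => e; rewrite inE => /andP[eH ->].
by have /forall_inP/(_ _ eH)/andP[_ ->] := edge_subproof H.
Qed.
Definition reach_graph : graph V := Graph reach_graph_subproof.
Local Notation R := reach_graph.

Lemma subgraph_reach : subgraph R H.
Proof.
apply/andP; split; apply/subsetP => x; rewrite inE => /andP[] //.
Qed.

Lemma reach_connect x y : x \in reach H U -> y \in vert H ->
  connect (adj H) x y -> y \in reach H U.
Proof.
move=> /reachP[xH [u uU xu]] yH xy; apply/reachP; split => //; exists u => //.
have cs : connect_sym (adj H) by apply: sym_connect_sym => a b; rewrite adj_sym.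
by apply: connect_trans xu; rewrite cs.
Qed.

Lemma adj_reach x y : adj R x y = [&& adj H x y, x \in reach H U & y \in reach H U].
Proof.
by rewrite {1}/adj inE; congr (_ && _); rewrite subUset !sub1set.
Qed.

Lemma reach_path x p : x \in reach H U -> path (adj H) x p -> path (adj R) x p.
Proof.
elim: p x => //= y p IH x xR /andP[xy pp]; have /andP[_ yH] := adj_vert xy.
have yR : y \in reach H U by apply: reach_connect xR yH (connect1 xy).
by rewrite adj_reach xy xR yR /= IH.
Qed.

Lemma convex_reach : convex R H.
Proof.
move=> x y xR yR; apply: dist_within => n; first exact: within_sub subgraph_reach.
move=> /within_walk[p [pp <- sp]]; apply: (within_le sp); apply: within_path.
exact: reach_path.
Qed.

(** For adjacent x and y, with p and q their projections,
    d(x, p) + d(p, q) = d(x, q) <= 1 + d(y, q), and likewise with x and y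
    exchanged; adding up gives d(p, q) <= 1. *)
Lemma nearest_is_gmap : is_gmap (@nearest D) R U.
Proof.
split=> [x|x y]; first exact: nearest_vert.
rewrite adj_reach => /and3P[xy xR yR].
have xU := nearest_vert xR; have yU := nearest_vert yR.
have xy1 : within H 1 x y.
  by apply: (@within_path _ H x [:: y]); rewrite /= xy.
have fin z : z \in reach H U -> exists m, dist H z (nearest z) = Some m.
  move=> zR; have /reachP[_ [u uU /connect_within[n [m + _]]]] := zR.
  by rewrite (nearest_dist zR uU); case: dist => // a _; exists a.
have [a da] := fin x xR; have [b db] := fin y yR.
have [c dc cle] := within_trans xy1 (within_dist db).
have [d dd dle] := within_trans (within_sym xy1) (within_dist da).
move: dc dd; rewrite (nearest_dist xR yU) (nearest_dist yR xU) da db.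
rewrite (dist_sym H (nearest y)); case dxy: dist => [[|e]|] //= [ec] [ed].
  by right; apply: dist0 dxy.
have e0 : e = 0%N by lia.
move: dxy; rewrite e0 -dist_UH // => /dist_path[p [pp lp sp]]; left.
by case: p pp lp sp => [|z [|]] //= + <- _; rewrite andbT.
Qed.
Definition nearest_gmap : gmap R U := Gmap nearest_is_gmap.

(** The chains of H split as those of the reachable part and those of the other
    components; restr_reach is the first projection, as gen R k l s = 0 when s is
    not contained in the reachable part. *)
Definition restr_reach k l : MC H k l -> MC R k l :=
  lin_ext (fun t : mtuple H k l => gen R k l (val t)).
HB.instance Definition _ k l := GRing.Additive.copy (@restr_reach k l)
  (lin_ext (fun t : mtuple H k l => gen R k l (val t))).

Lemma is_gen_reach l s : is_gen R l s = all [in reach H U] s && is_gen H l s.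
Proof. exact: is_gen_convex subgraph_reach convex_reach l s. Qed.

Lemma restr_reach_gen k l s : restr_reach (gen H k l s) = gen R k l s.
Proof.
rewrite /restr_reach (lin_ext_gen H (fun s => gen R k l s)); case: ifPn => // ns.
apply: coef_ext => s'; rewrite (raddf0 (coef s')) coef_gen is_gen_reach.
by case: eqP ns => //= _ /negPf ->; rewrite andbF.
Qed.

Lemma length_connect l x s : length H (x :: s) = Some l ->
  {in x :: s, forall y, connect (adj H) x y}.
Proof.
elim: s l x => [|y s IH] l x; first by move=> _ z; rewrite inE => /eqP->.
move=> /lengthS[a [b [da /IH cy _]]] z; rewrite inE => /orP[/eqP->//|/cy].
by apply: connect_trans; apply: within_connect (within_dist da).
Qed.

(** A tuple of finite length lies in one component, so that deleting an inner
    entry cannot bring it into the reachable part. *)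
Lemma all_reach_del l i s : (0 < i)%N -> is_gen H l s ->
  all [in reach H U] (del i s) -> all [in reach H U] s.
Proof.
move=> i0 /and3P[/allP sH _ /eqP ls]; case: s sH ls => // x s sH ls.
case: i i0 => // i _ /andP[xR _]; apply/allP => y ys.
by apply: reach_connect xR (sH y ys) (length_connect ls ys).
Qed.

Lemma restr_reach_bdry k l c : bdry R k l (restr_reach c) = restr_reach (bdry H k l c).
Proof.
suff /(_ c) : bdry R k l \o @restr_reach k l =1 @restr_reach k.-1 l \o bdry H k l by [].
apply: additive_ext => s sk gs /=; rewrite restr_reach_gen (@bdryE _ H) //; last by left.
rewrite {1}/bdry_gen raddf_sum.
have [rs|nrs] := boolP (all [in reach H U] s).
  rewrite bdryE //; last by left; rewrite is_gen_reach rs.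
  by apply: eq_bigr => i _; rewrite raddfMz /= restr_reach_gen.
rewrite gen_invalid ?is_gen_reach ?(negPf nrs) // raddf0 big_nat big1 // => i /andP[i0 _].
rewrite raddfMz /= restr_reach_gen gen_invalid ?mul0rz // is_gen_reach negb_and.
by apply/orP; left; apply: contra nrs; apply: all_reach_del gs.
Qed.

Definition retract l k : {additive MC H k l -> MC U k l} :=
  @MCmap _ _ _ _ nearest_gmap k l \o @restr_reach k l.

Lemma retract_bdry l k c : bdry U k l (retract l k c) = retract l k.-1 (bdry H k l c).
Proof. by rewrite /= MCmap_bdry restr_reach_bdry. Qed.

Lemma retract_incl k l (c : MC U k l) :
  retract l k (MCmap (pd_jH D) c) = c.
Proof.
suff /(_ c) : retract l k \o @MCmap _ _ _ _ (pd_jH D) k l =1 idfun by [].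
apply: additive_ext => s sk gs /=; rewrite MCmap_genE //; last by left.
rewrite map_id restr_reach_gen; have sU : {in s, forall x, x \in vert U}.
  by case/and3P: gs => /allP.
rewrite MCmap_genE //; last first.
  left; rewrite is_gen_reach; apply/andP; split.
    by apply/allP => x /sU; exact: vert_U_reach.
  by move: gs; rewrite (is_gen_convex (graphI_subr G H) (@convex_UH D)) => /andP[].
by rewrite map_id_in // => x /sU; exact: nearest_id.
Qed.

Definition MHretract k l : MH H k l -> MH U k l := MHinduced (@retract_bdry l) (k := k).
HB.instance Definition _ k l := GRing.Additive.copy (@MHretract k l)
  (MHinduced (@retract_bdry l) (k := k)).

Lemma MHretractK k l (a : MH U k l) : MHretract (MHmap (pd_jH D) a) = a.
Proof.
rewrite -[a]homology_class_repr MHmap_class /MHretract MHinduced_class.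
by congr homology_class; apply: val_inj; apply: retract_incl.
Qed.

Definition MVretr k l (ab : MH G k l * MH H k l) : MH U k l := - MHretract ab.2.
Lemma MVretr_is_zmod_morphism k l : zmod_morphism (@MVretr k l).
Proof. by move=> a b; rewrite /MVretr /= raddfB opprB opprK addrC. Qed.
HB.instance Definition _ k l := GRing.isZmodMorphism.Build _ _
  (@MVretr k l) (@MVretr_is_zmod_morphism k l).

Lemma MVinK k l : cancel (@MVin k l D) (@MVretr k l).
Proof. by move=> a; rewrite /MVretr /MVin /= raddfN opprK; apply: MHretractK. Qed.

End Retraction.

(** * Exactness *)

Section Exactness.
Variable D : proj_decomp.
Local Notation X := (pd_X D).
Local Notation G := (pd_G D).
Local Notation H := (pd_H D).
Local Notation U := (pd_GH D).
Implicit Types (k l : nat).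

Lemma MVin_inj k l : injective (@MVin k l D).
Proof. exact: can_inj (@MVinK D k l). Qed.

Lemma MVout_in k l (a : MH U k l) : MVout D (MVin D a) = 0.
Proof.
rewrite /MVout /MVin /= raddfN (@MHmap_square _ _ _ _ _ _ _ _ _ _ (pd_jH D) (pd_iH D)) //.
by rewrite subrr.
Qed.

Lemma MVout_class k l (a : cycle G k l) (b : cycle H k l) :
  MVout D (homology_class a, homology_class b) =
  homology_class (cycle_map (pd_iG D) a + cycle_map (pd_iH D) b).
Proof. by rewrite /MVout !MHmap_class raddfD. Qed.

(** By excision a class is represented by a sum of chains a of G and b of H whose
    boundaries are opposite chains of the intersection.  Moving the projection of
    b from b to a makes both of them cycles. *)
Lemma MVout_surj k l (x : MH X k l) : exists ab, MVout D ab = x.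
Proof.
rewrite -[x]homology_class_repr; set z := repr x.
have bz : bdry X k l (val z) = 0 by apply/eqP/(valP z).
have [|w /nonmixed_split[a [b eab]]] := @excision D k l (val z).
  by rewrite bz => s _; rewrite raddf0.
have bab : MCmap (pd_iG D) (bdry G k l a) + MCmap (pd_iH D) (bdry H k l b) = 0.
  rewrite -!MCmap_bdry -raddfD /= -eab raddfB /= bz sub0r.
  by have /= -> := @bdry_bdry _ X k.+1 l w; rewrite oppr0.
have [c [ba bb]] := chain_exact_mid bab.
pose d := retract D l k b.
have bd : bdry U k l d = - c.
  by rewrite /d retract_bdry bb raddfN retract_incl.
have ca : is_cycle (a + MCmap (pd_jG D) d).
  by rewrite /is_cycle raddfD /= MCmap_bdry bd raddfN ba subrr.
have cb : is_cycle (b - MCmap (pd_jH D) d).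
  by rewrite /is_cycle raddfB /= MCmap_bdry bd raddfN opprK bb addNr.
exists (homology_class (Cycle ca), homology_class (Cycle cb)).
rewrite MVout_class; apply: (@homology_class_eq _ _ _ _ _ _ (- w)).
rewrite /= raddfD raddfB /= raddfN.
rewrite (@MCmap_square _ _ _ _ _ _ _ _ (pd_jG D) (pd_iG D) (pd_jH D) (pd_iH D)) //.
by rewrite addrACA subrr addr0 -eab addrAC subrr add0r.
Qed.

(** If a + b bounds in X, excision makes the bounding chain nonmixed, and its two
    parts correct a and b to chains whose sum is 0, hence which come from the
    intersection. *)
Lemma MVexact k l (ab : MH G k l * MH H k l) :
  MVout D ab = 0 <-> exists c, ab = MVin D c.
Proof.
split=> [|[c ->]]; last exact: MVout_in.
case: ab => a b; rewrite -[a]homology_class_repr -[b]homology_class_repr.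
set y := repr a; set z := repr b; rewrite MVout_class => /eqP.
rewrite homology_class_eq0 => /asboolP[w /= ew].
have [|v /nonmixed_split[w1 [w2 ev]]] := @excision D k.+1 l w.
  rewrite -ew => s /andP[/hasP[x xs hx] /hasP[y' ys gy]]; rewrite raddfD /=.
  rewrite (coef_incl _ (@dist_GX D)) (coef_incl _ (@dist_HX D)) !coef_eq0 //.
    rewrite (is_gen_convex (pd_subH D) (@dist_HX D)).
    by apply/negP => /and3P[_ /allP/(_ _ ys) yH]; rewrite /gonly yH in gy.
  rewrite (is_gen_convex (pd_subG D) (@dist_GX D)).
  by apply/negP => /and3P[_ /allP/(_ _ xs) xG]; rewrite /honly xG in hx.
have bv : bdry X k.+1 l w =
    MCmap (pd_iG D) (bdry G k.+1 l w1) + MCmap (pd_iH D) (bdry H k.+1 l w2).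
  rewrite -!MCmap_bdry -raddfD /= -ev raddfB /=.
  by have /= -> := @bdry_bdry _ X k.+2 l v; rewrite subr0.
have [|c [ec1 ec2]] := @chain_exact_mid D k l
    (val y - bdry G k.+1 l w1) (val z - bdry H k.+1 l w2).
  by rewrite !raddfB /= addrACA -opprD -bv ew subrr.
have cc : is_cycle c.
  apply/eqP; apply: (MCmap_incl_inj (AB := graphI_subl G H) (@convex_UG D)).
  rewrite -/(pd_jG D) -MCmap_bdry -ec1 raddf0 raddfB /= (eqP (valP y)) sub0r.
  by have /= -> := @bdry_bdry _ G k.+1 l w1; rewrite oppr0.
exists (homology_class (Cycle cc)); rewrite /MVin !MHmap_class -raddfN.
congr (_, _).
  by apply: (@homology_class_eq _ _ _ _ _ _ w1); rewrite /= -ec1 opprB addrC subrK.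
by apply: (@homology_class_eq _ _ _ _ _ _ w2); rewrite raddfN /= -ec2 opprB addrC subrK.
Qed.

Lemma MV_short_exact k l : short_exact (@MVin k l D) (@MVout k l D).
Proof.
split; [exact: MVin_inj|exact: MVexact|exact: MVout_surj].
Qed.

End Exactness.

(** * Splittings of short exact sequences *)

Section Sections.
Variables (A B C : zmodType) (i : {additive A -> B}) (p : {additive B -> C}).
Variable r : {additive B -> A}.
Hypotheses (ip : short_exact i p) (ir : cancel i r).

Lemma split_inj b b' : p b = p b' -> r b = r b' -> b = b'.
Proof.
move=> pb rb; have [_ ex _] := ip.
have /ex[a ba] : p (b - b') = 0 by rewrite raddfB /= pb subrr.
have : r (b - b') = 0 by rewrite raddfB /= rb subrr.
by rewrite ba ir => a0; move/eqP: ba; rewrite a0 raddf0 subr_eq0 => /eqP.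
Qed.

(** The two equations p (s c) = c and r (s c) = 0 determine s, which makes it
    additive; for the same reason it is natural as soon as i, p and r are. *)
Lemma section_exists :
  exists s : {additive C -> B}, splitting i p r s /\ forall c, r (s c) = 0.
Proof.
have [ij ex su] := ip; have pi0 a : p (i a) = 0 by apply/ex; exists a.
have [s0 ps rs] : exists2 s0 : C -> B, (forall c, p (s0 c) = c) & forall c, r (s0 c) = 0.
  exists (fun c => let b := projT1 (cid (su c)) in b - i (r b)) => c.
    by case: cid => b /= pb; rewrite raddfB /= pi0 subr0.
  by rewrite raddfB /= ir subrr.
have sB : zmod_morphism s0.
  move=> c c'; apply: split_inj; first by rewrite (raddfB p) /= !ps.
  by rewrite (raddfB r) /= !rs subrr.
have [s es] : exists s : {additive C -> B}, s =1 s0.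
  by exists (HB.pack_for {additive C -> B} s0 (GRing.isZmodMorphism.Build C B s0 sB)).
exists s; split=> [|c]; last by rewrite es.
split=> // [c|b]; first by rewrite es.
by apply: split_inj; rewrite raddfD /= es ?pi0 ?ps ?add0r // ir rs addr0.
Qed.
End Sections.

(** * Naturality *)

Section Naturality.
Variables (D D' : proj_decomp) (f : decomp_map D D').

Lemma MVin_natural k l (a : MH (pd_GH D) k l) :
  MHmap2 f (MVin D a) = MVin D' (MHmap (dm_GH f) a).
Proof.
by rewrite /MHmap2 /MVin /= raddfN; congr (_, - _); apply: MHmap_square.
Qed.

Lemma MVout_natural k l (ab : MH (pd_G D) k l * MH (pd_H D) k l) :
  MHmap f (MVout D ab) = MVout D' (MHmap2 f ab).
Proof. by rewrite /MHmap2 /MVout raddfD /=; congr (_ + _); apply: MHmap_square. Qed.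

Hypothesis fp : is_proj_decomp_map f.

Lemma mem_reach x :
  (f x \in reach (pd_H D') (pd_GH D')) = (x \in reach (pd_H D) (pd_GH D)).
Proof. by have [-> _] := fp; rewrite [RHS]inE. Qed.

Lemma reach_gmap : is_gmap f (reach_graph D) (reach_graph D').
Proof.
split=> [x|x y]; first by rewrite /= mem_reach.
rewrite !adj_reach !mem_reach => /and3P[xy -> ->]; rewrite !andbT.
exact: (dm_subH f).2.
Qed.
Definition dm_reach := Gmap reach_gmap.

Lemma retract_natural k l (c : MC (pd_H D) k l) :
  MCmap (dm_GH f) (retract D l k c) = retract D' l k (MCmap (dm_H f) c).
Proof.
have [_ fpr] := fp.
have -> : retract D' l k (MCmap (dm_H f) c) =
    MCmap (nearest_gmap D') (MCmap dm_reach (restr_reach c)).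
  rewrite /=; congr MCmap.
  suff /(_ c) : @restr_reach D' k l \o @MCmap _ _ _ _ (dm_H f) k l =1
    @MCmap _ _ _ _ dm_reach k l \o @restr_reach D k l by [].
  apply: additive_ext => s sk gs /=.
  rewrite MCmap_genE //; last by left.
  rewrite !restr_reach_gen; have [rs|nrs] := boolP (all [in reach (pd_H D) (pd_GH D)] s).
    by rewrite MCmap_genE // is_gen_reach rs gs; left.
  rewrite (gen_invalid k (s := s)) ?is_gen_reach ?(negPf nrs) // raddf0.
  rewrite gen_invalid // is_gen_reach all_map.
  have -> : all (preim (dm_H f) [in reach (pd_H D') (pd_GH D')]) s =
      all [in reach (pd_H D) (pd_GH D)] s.
    by apply: eq_all => x; apply: mem_reach.
  by rewrite (negPf nrs).
by apply: MCmap_square => x xR; apply: fpr.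
Qed.

Lemma MVretr_natural k l (ab : MH (pd_G D) k l * MH (pd_H D) k l) :
  MHmap (dm_GH f) (MVretr ab) = MVretr (MHmap2 f ab).
Proof.
rewrite /MVretr /MHmap2 /= raddfN; congr (- _); case: ab => _ b /=.
rewrite -[b]homology_class_repr MHmap_class /MHretract !MHinduced_class MHmap_class.
by congr homology_class; apply: val_inj; apply: retract_natural.
Qed.
End Naturality.

Theorem theorem29 :
  (forall (D : proj_decomp) (k l : nat),
     short_exact (@MVin k l D) (@MVout k l D)) /\
  (forall (D D' : proj_decomp) (f : decomp_map D D') (k l : nat),
     (forall a : MH (pd_GH D) k l,
        MHmap2 f (MVin D a) = MVin D' (MHmap (dm_GH f) a)) /\
     (forall ab : MH (pd_G D) k l * MH (pd_H D) k l,
        MHmap f (MVout D ab) = MVout D' (MHmap2 f ab))) /\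
  exists (r : forall (D : proj_decomp) (k l : nat),
            {additive (MH (pd_G D) k l * MH (pd_H D) k l)%type ->
               MH (pd_GH D) k l})
         (s : forall (D : proj_decomp) (k l : nat),
            {additive MH (pd_X D) k l ->
               (MH (pd_G D) k l * MH (pd_H D) k l)%type}),
    (forall (D : proj_decomp) (k l : nat),
       splitting (@MVin k l D) (@MVout k l D) (r D k l) (s D k l)) /\
    (forall (D D' : proj_decomp) (f : decomp_map D D'),
       is_proj_decomp_map f ->
       forall k l : nat,
         (forall ab : MH (pd_G D) k l * MH (pd_H D) k l,
            MHmap (dm_GH f) (r D k l ab) = r D' k l (MHmap2 f ab)) /\
         (forall x : MH (pd_X D) k l,
            MHmap2 f (s D k l x) = s D' k l (MHmap f x))).
Proof.
split; first exact: MV_short_exact.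
split=> [D D' f k l|]; first by split; [exact: MVin_natural|exact: MVout_natural].
have sec D k l := cid (section_exists (@MV_short_exact D k l) (@MVinK D k l)).
exists (fun D k l => @MVretr D k l), (fun D k l => projT1 (sec D k l)); split.
  by move=> D k l; case: (sec D k l) => s [].
move=> D D' f fp k l; split=> [ab|x]; first exact: MVretr_natural.
apply: (split_inj (@MV_short_exact D' k l) (@MVinK D' k l)).
  rewrite /= -MVout_natural; case: (sec D k l) => s [[_ ps _] _] /=.
  by case: (sec D' k l) => s' [[_ ps' _] _] /=; rewrite ps ps'.
rewrite /= -MVretr_natural //; case: (sec D k l) => s [_ rs] /=.
by case: (sec D' k l) => s' [_ rs'] /=; rewrite rs rs' raddf0.
Qed.
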